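(* Let $\mathbf{d}$ be a linear continuous dilation in $\mathbb{R}^n$ monotone with respect to a norm $\|\cdot\|_{\mathbb{R}^n}$, and $\tilde{\mathbf{d}}$ a linear continuous dilation in $\mathbb{R}^k$ monotone with respect to a norm $\|\cdot\|_{\mathbb{R}^k}$. Let $f\in C(\mathbb{R}^n\times\mathbb{R}^k,\mathbb{R}^n)$ satisfy, for some $\mu>-1$, $$f(\mathbf{d}(s)x,\tilde{\mathbf{d}}(s)q)=e^{\mu s}\mathbf{d}(s)f(x,q)\quad\forall s\in\mathbb{R},\ x\in\mathbb{R}^n,\ q\in\mathbb{R}^k.$$ Let $\Omega=\{x\in\mathbb{R}^n:\phi_i(x)\ge0,\ i=1,\dots,p\}$ have non-empty interior, where each $\phi_i\in C(\mathbb{R}^n,\mathbb{R})\cap C^1(\mathbb{R}^n\setminus\{0\},\mathbb{R})$ is $\mathbf{d}$-homogeneous of degree $\nu_i>0$. Consider the system $$\dot x=f(x,q),\quad t>t_0,\quad x(t_0)=x_0,\qquad q\in L^\infty(\mathbb{R},\mathbb{R}^k),$$ and assume it is forward complete. Assume further that for any $q\in L^\infty(\mathbb{R},\mathbb{R}^k)$ and any $x_0\in\partial\Omega\setminus\{0\}$ the solution of the system is forward unique (at least locally in time), while a solution initiated at $x(t_0)=0$ may leave the origin only by entering the set $\Omega$. Then $\Omega$ is robustly positively invariant for the system if and only if $$f(x,q)\in\mathcal{C}_\Omega(x),\quad\forall x\in\partial\Omega\cap S,\ \forall q\in\mathbb{R}^k,$$ where $S=\{x\in\mathbb{R}^n: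\|x\|_{\mathbb{R}^n}=1\}$.
   Context: A linear continuous dilation in $\mathbb{R}^n$ is a family $\mathbf{d}(s)=e^{sG_{\mathbf{d}}}$, $s\in\mathbb{R}$, $G_{\mathbf{d}}\in\mathbb{R}^{n\times n}$, such that $\liminf_{s\to+\infty}\|\mathbf{d}(s)x\|=+\infty$ and $\limsup_{s\to-\infty}\|\mathbf{d}(s)x\|=0$ for all $x\ne 0$ (similarly for $\tilde{\mathbf{d}}$ in $\mathbb{R}^k$). It is monotone with respect to a norm if $s\mapsto\|\mathbf{d}(s)x\|$ is strictly increasing for each $x\neq 0$. A function $h:\mathbb{R}^n\to\mathbb{R}$ is $\mathbf{d}$-homogeneous of degree $\nu$ if $h(\mathbf{d}(s)x)=e^{\nu s}h(x)$ for all $x\in\mathbb{R}^n,s\in\mathbb{R}$. The (Bouligand) tangent cone to $\Omega$ at $x\in\Omega$ is $\mathcal{C}_\Omega(x)=\{z\in\mathbb{R}^n:\liminf_{h\to0^+}\frac{1}{h}\inf_{y\in\Omega}\|x+hz-y\|=0\}$. $L^\infty(\mathbb{R},\mathbb{R}^k)$ is the set of essentially bounded functions. The system is forward complete if all its solutions (for any initial state and any $q\in L^\infty(\mathbb{R},\mathbb{R}^k)$) are defined for all $t\ge t_0$. $\Omega$ is robustly positively invariant if $x(t_0)\in\Omega$ implies $x(t)\in\Omega$ for all $t\ge t_0$ and any $q\in L^\infty(\mathbb{R},\mathbb{R}^k)$. *)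

(* Defs.v *)
From mathcomp Require Import all_boot all_order all_algebra.
From mathcomp Require Import all_classical all_reals all_analysis.

Set Implicit Arguments.
Unset Strict Implicit.
Unset Printing Implicit Defensive.

Import Order.TTheory GRing.Theory Num.Theory.
Import numFieldNormedType.Exports.

Local Open Scope classical_set_scope.
Local Open Scope ring_scope.

(* R^n is 'cV[R]_n. Its topology and the norm `|_| are the library's (entrywise
   maximum); the norms of the statement are arbitrary functions satisfying
   is_norm, which induce the same topology. *)

Definition is_norm (R : realType) (V : lmodType R) (N : V -> R) : Prop :=
  [/\ forall x y, N (x + y) <= N x + N y,
      forall a x, N (a *: x) = `|a| * N x
    & forall x, N x = 0 -> x = 0].

Definition boundary (T : topologicalType) (A : set T) : set T :=
  closure A `\` A°.

Definition mexp (R : realType) (n : nat) (A : 'M[R]_n) : 'M[R]_n :=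
  limn (series (fun k => (k`!%:R)^-1 *: A ^+ k)).

Definition linear_dilation (R : realType) (n : nat) (N : 'cV[R]_n -> R)
    (d : R -> 'M[R]_n) : Prop :=
  [/\ exists G : 'M[R]_n, forall s, d s = mexp (s *: G),
      forall x, x != 0 -> limf_einf (fun s => (N (d s *m x))%:E) +oo%R = +oo%E
    & forall x, x != 0 -> limf_esup (fun s => (N (d s *m x))%:E) -oo%R = 0%E].

Definition monotone_dilation (R : realType) (n : nat) (N : 'cV[R]_n -> R)
    (d : R -> 'M[R]_n) : Prop :=
  forall x, x != 0 -> {homo (fun s => N (d s *m x)) : s t / s < t}.

Definition homogeneous (R : realType) (n : nat) (d : R -> 'M[R]_n) (nu : R)
    (h : 'cV[R]_n -> R) : Prop :=
  forall s x, h (d s *m x) = expR (nu * s) * h x.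

(* In finite dimension, continuity of all directional derivatives is
   continuity of the differential. *)
Definition C1_off_origin (R : realType) (n : nat) (h : 'cV[R]_n -> R) : Prop :=
  forall x, x != 0 ->
    differentiable h x /\ forall v, {for x, continuous (fun y => 'D_v h y)}.

Definition tangent_cone (R : realType) (n : nat) (N : 'cV[R]_n -> R)
    (Omega : set 'cV[R]_n) (x : 'cV[R]_n) : set 'cV[R]_n :=
  [set z | limf_einf
     (fun h : R => (h^-1 * inf [set N (x + h *: z - y) | y in Omega])%:E)
     0^'+ = 0%E].

Definition Linfty (R : realType) (k : nat) (q : R -> 'cV[R]_k) : Prop :=
  forall i, (fun t => q t i 0) \in Lfun (@lebesgue_measure R) +oo%E.

Definition abs_continuous (R : realType) (n : nat) (a b : R)
    (x : R -> 'cV[R]_n) : Prop :=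
  forall e : R, 0 < e -> exists2 delta : R, 0 < delta &
    forall (m : nat) (u v : nat -> R),
      (forall i, (i < m)%N -> a <= u i /\ u i <= v i /\ v i <= b) ->
      trivIset `I_m (fun i => `]u i, v i[%classic) ->
      \sum_(i < m) (v i - u i) < delta ->
      \sum_(i < m) `|x (v i) - x (u i)| < e.

(* Caratheodory solution on [t0, T[ with t0 < T <= +oo. The trajectory x is a
   total function whose values outside [t0, T[ are irrelevant. *)
Definition solution (R : realType) (n k : nat)
    (f : 'cV[R]_n * 'cV[R]_k -> 'cV[R]_n) (q : R -> 'cV[R]_k) (t0 : R)
    (x0 : 'cV[R]_n) (T : \bar R) (x : R -> 'cV[R]_n) : Prop :=
  [/\ (t0%:E < T)%E,
      x t0 = x0,
      forall b : R, t0 <= b -> (b%:E < T)%E -> abs_continuous t0 b x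
    & {ae @lebesgue_measure R, forall t : R, t0 < t -> (t%:E < T)%E ->
         is_derive t (1 : R) x (f (x t, q t))}].

Definition maximal_solution (R : realType) (n k : nat)
    (f : 'cV[R]_n * 'cV[R]_k -> 'cV[R]_n) (q : R -> 'cV[R]_k) (t0 : R)
    (x0 : 'cV[R]_n) (T : \bar R) (x : R -> 'cV[R]_n) : Prop :=
  solution f q t0 x0 T x /\
  ~ exists (T' : \bar R) (y : R -> 'cV[R]_n),
      [/\ (T < T')%E, solution f q t0 x0 T' y
        & forall t : R, t0 <= t -> (t%:E < T)%E -> y t = x t].

Definition forward_complete (R : realType) (n k : nat)
    (f : 'cV[R]_n * 'cV[R]_k -> 'cV[R]_n) (t0 : R) : Prop :=
  forall q x0 T x, Linfty q -> maximal_solution f q t0 x0 T x -> T = +oo%E.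

(* Local uniqueness to the right of t0; the length of the common interval may
   depend on the two solutions. *)
Definition forward_unique_at (R : realType) (n k : nat)
    (f : 'cV[R]_n * 'cV[R]_k -> 'cV[R]_n) (t0 : R) (x0 : 'cV[R]_n) : Prop :=
  forall q T1 T2 x y, Linfty q ->
    solution f q t0 x0 T1 x -> solution f q t0 x0 T2 y ->
    \forall t \near t0^'+, x t = y t.

(* tau is the instant at which the solution leaves the origin: it vanishes on
   [t0, tau] but on no right neighbourhood of tau. *)
Definition leaves_origin_into (R : realType) (n k : nat)
    (f : 'cV[R]_n * 'cV[R]_k -> 'cV[R]_n) (t0 : R)
    (Omega : set 'cV[R]_n) : Prop :=
  forall q T x, Linfty q -> solution f q t0 0 T x ->
  forall tau : R, t0 <= tau -> (tau%:E < T)%E ->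
    (forall t, t0 <= t <= tau -> x t = 0) ->
    ~ (\forall t \near tau^'+, x t = 0) ->
    \forall t \near tau^'+, Omega (x t).

Definition robustly_positively_invariant (R : realType) (n k : nat)
    (f : 'cV[R]_n * 'cV[R]_k -> 'cV[R]_n) (t0 : R)
    (Omega : set 'cV[R]_n) : Prop :=
  forall q x0 x, Linfty q -> Omega x0 -> solution f q t0 x0 +oo%E x ->
  forall t, t0 <= t -> Omega (x t).

(* Main.v *)
Require Import Defs.
From mathcomp Require Import all_boot all_order all_algebra.
From mathcomp Require Import all_classical all_reals all_analysis.
From mathcomp Require Import measurable_realfun ess_sup_inf ring lra.
Set Implicit Arguments.
Unset Strict Implicit.
Unset Printing Implicit Defensive.
Import Order.TTheory GRing.Theory Num.Theory.
Import numFieldNormedType.Exports.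
Local Open Scope classical_set_scope.
Local Open Scope ring_scope.

(** Tangency is first freed from the sphere.  Each d(s) is a linear bijection
    that preserves Omega and its boundary, and homogeneity of f says that d(s)
    maps f(x, q) to a positive multiple of f(d(s) x, dt(s) q).  Hence tangency
    at d(s) x for every input implies tangency at x for every input, and since
    s |-> N(d(s) x) is continuous and runs from below 1 to above 1
    (dilation_reaches_sphere), tangency on the sphere amounts to tangency at
    every nonzero boundary point.  Bijectivity of d(s) comes from monotonicity:
    a kernel vector of d(s) would have negative norm at an earlier time.

    Necessity (nagumo_necessity).  Freeze the input at v.  There is a solution
    that starts at x and has right derivative f(x, v) there; extended to a
    maximal one by Zorn's lemma (maximal_extension), it is global by forward
    completeness, so it stays in Omega and its chords show that f(x, v) is
    tangent.

    Sufficiency (nagumo_sufficiency).  If a solution leaves Omega, restart it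
    at its last instant tau in Omega.  The value at tau is a boundary point.
    If it is 0, the hypothesis on the origin is contradicted.  Otherwise
    forward uniqueness reduces the claim to exhibiting one solution that
    remains in Omega for a short time, which is the viability theorem.

    The viability theorem (viability_bounded, viability) holds for every closed
    set K to which f(p, v) is tangent at the points p of K near x0, and every
    essentially bounded measurable input.  It is proved by an Euler scheme in
    which the state is replaced by its nearest point in K before f is evaluated:
      X_(j+1) = X_j + the integral over the j-th step of f(pr X_j, q(s)) ds.
    The vector X_j - pr X_j is a proximal normal, so its scalar product with
    any tangent vector at pr X_j is nonpositive (nearest_tangent_le0).  The
    squared distance to K therefore grows by O(h^2) in a step of length h, and
    by O(h) altogether (node_dist).  As the input is integrated and never
    sampled, its measurability suffices.  Ascoli's argument extracts a uniform
    limit, dominated convergence gives its integral equation, and Lebesgue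
    differentiation gives the equation almost everywhere.  For K the whole
    space this is also the existence theorem that necessity needs. *)

(** * Finite-dimensional norms and compactness *)

Lemma near_dist_lt (R : realType) (V : normedModType R) (v : V) (e : R) :
  0 < e -> \forall w \near v, `|v - w| < e.
Proof. by move=> e0; apply/nbhs_normP; exists e. Qed.

Lemma cvnorm_ge (R : realType) n (u : 'cV[R]_n) i : `|u i 0| <= `|u|.
Proof.
rewrite [leRHS]/Num.Def.normr /= mx_normrE.
exact: (le_bigmax _ (fun ij : 'I_n * 'I_1 => `|u ij.1 ij.2|) (i, 0)).
Qed.

Lemma cvnorm_le (R : realType) n (u : 'cV[R]_n) (c : R) :
  0 <= c -> (forall i, `|u i 0| <= c) -> `|u| <= c.
Proof.
move=> c0 uc; rewrite [leLHS]/Num.Def.normr /= mx_normrE.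
by apply: bigmax_le => // -[i j] _ /=; rewrite ord1; exact: uc.
Qed.

Lemma cvnorm_witness (R : realType) n (u : 'cV[R]_n) :
  `|u| != 0 -> exists i, `|u| = `|u i 0|.
Proof.
by move=> /(@mx_norm_neq0 R n 1 u)[[i j] /=]; rewrite (ord1 j); exists i.
Qed.

Lemma trmx_norm (R : realType) n (u : 'cV[R]_n) : `|u^T| = `|u|.
Proof.
apply/le_anti/andP; split.
  rewrite [leLHS]/Num.Def.normr /= mx_normrE; apply: bigmax_le => // -[i j] _ /=.
  by rewrite mxE ord1; exact: cvnorm_ge.
apply: cvnorm_le => // i; rewrite [leRHS]/Num.Def.normr /= mx_normrE.
have := le_bigmax 0 (fun ij : 'I_1 * 'I_n => `|u^T ij.1 ij.2|) (0, i).
by rewrite /= mxE.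
Qed.

(** Transposition is an isometry onto row vectors, for which bounded closed
    sets are known to be compact. *)
Lemma cV_compact (R : realType) n (A : set 'cV[R]_n) :
  bounded_set A -> closed A -> compact A.
Proof.
move=> bA cA.
have ctr : continuous (fun v : 'rV[R]_n => v^T).
  move=> v; have FF := nbhs_filter v.
  apply/cvgrPdist_lt => e e0; near=> w.
  rewrite -linearB/= -trmx_norm trmxK.
  by near: w; exact: (@near_dist_lt _ 'rV[R]_n).
have -> : A = (fun v : 'rV[R]_n => v^T) @` [set v | A v^T].
  apply/seteqP; split=> [x Ax|_ [v Av <-]//].
  by exists x^T => /=; rewrite ?trmxK.
apply: continuous_compact; first exact: continuous_subspaceT.
apply: bounded_closed_compact.
  case: bA => M [Mr bA]; exists M; split => // y /bA h v Av.
  have /= vy : `|v^T| <= y by exact: h Av.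
  have vv : `|v| = `|v^T| by rewrite -(trmx_norm v^T) trmxK.
  by rewrite -vv in vy.
exact: (continuous_closedP _).1.
Unshelve. all: by end_near. Qed.

Definition dot (R : realType) n (u v : 'cV[R]_n) : R := \sum_i u i 0 * v i 0.

Section dot.
Context (R : realType) (n : nat).
Implicit Types u v w : 'cV[R]_n.

Lemma dotC u v : dot u v = dot v u.
Proof. by apply: eq_bigr => i _; rewrite mulrC. Qed.

Lemma dotDr u v w : dot u (v + w) = dot u v + dot u w.
Proof. by rewrite -big_split; apply: eq_bigr => i _; rewrite mxE mulrDr. Qed.

Lemma dotZr a u v : dot u (a *: v) = a * dot u v.
Proof. by rewrite mulr_sumr; apply: eq_bigr => i _; rewrite mxE mulrCA. Qed.

Lemma dotBr u v w : dot u (v - w) = dot u v - dot u w.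
Proof. by rewrite dotDr -scaleN1r dotZr mulN1r. Qed.

Lemma dotDl u v w : dot (v + w) u = dot v u + dot w u.
Proof. by rewrite dotC dotDr !(dotC u). Qed.

Lemma dotBl u v w : dot (v - w) u = dot v u - dot w u.
Proof. by rewrite dotC dotBr !(dotC u). Qed.

Lemma dotDD u v : dot (u + v) (u + v) = dot u u + 2 * dot u v + dot v v.
Proof. by rewrite dotDl !dotDr (dotC v u); ring. Qed.

Lemma dotBB u v : dot (u - v) (u - v) = dot u u - 2 * dot u v + dot v v.
Proof. by rewrite dotBl !dotBr (dotC v u); ring. Qed.

Lemma dot_norm_le u v : `|dot u v| <= n%:R * (`|u| * `|v|).
Proof.
have -> : n%:R * (`|u| * `|v|) = \sum_(i < n) `|u| * `|v|.
  by rewrite sumr_const card_ord mulr_natl.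
rewrite (le_trans (ler_norm_sum _ _ _))// ler_sum// => i _.
by rewrite normrM ler_pM ?cvnorm_ge.
Qed.

Lemma dot_ge_norm u : `|u| ^+ 2 <= dot u u.
Proof.
have [->|/cvnorm_witness[i ->]] := eqVneq `|u| 0.
  by rewrite expr0n; apply: sumr_ge0 => i _; rewrite -expr2 sqr_ge0.
rewrite /dot (bigD1 i)//= real_normK ?num_real// -expr2 lerDl.
by apply: sumr_ge0 => j _; rewrite -expr2 sqr_ge0.
Qed.
End dot.

Section norm_equivalence.
Context (R : realType) (n : nat) (N : 'cV[R]_n -> R) (hN : is_norm N).

Lemma is_norm_0 : N 0 = 0.
Proof. by case: hN => _ NZ _; rewrite -(scale0r 0) NZ normr0 mul0r. Qed.

Lemma is_norm_opp x : N (- x) = N x.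
Proof. by case: hN => _ NZ _; rewrite -scaleN1r NZ normrN1 mul1r. Qed.

(** A norm is continuous for the entrywise maximum, so it has a positive
    minimum on the compact unit sphere. *)
Lemma is_norm_ge0 x : 0 <= N x.
Proof.
case: hN => ND _ _; have := ND x (- x).
rewrite subrr is_norm_0 is_norm_opp; lra.
Qed.

Lemma is_norm_sum (I : finType) (F : I -> 'cV[R]_n) :
  N (\sum_i F i) <= \sum_i N (F i).
Proof.
elim/big_ind2 : _ => [|x a y b|//]; first by rewrite is_norm_0.
move=> xa yb; case: hN => ND _ _; rewrite (le_trans (ND _ _))// lerD//.
Qed.

Lemma is_norm_le : exists2 C, 0 < C & forall x, N x <= C * `|x|.
Proof.
pose e i : 'cV[R]_n := delta_mx i 0.
have s0 : 0 <= \sum_i N (e i) by apply: sumr_ge0 => i _; exact: is_norm_ge0.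
exists (\sum_i N (e i) + 1) => [|x]; first by rewrite ltr_wpDl.
have xE : x = \sum_i x i 0 *: e i.
  apply/colP => i; rewrite summxE (bigD1 i)//= big1 ?addr0 => [|j ji].
    by rewrite !mxE !eqxx mulr1.
  by rewrite !mxE (eq_sym i) (negbTE ji) mulr0.
rewrite [in leLHS]xE.
apply: (le_trans (is_norm_sum _)); rewrite mulrDl mul1r ler_wpDr// mulr_suml.
apply: ler_sum => i _; case: hN => _ -> _; rewrite mulrC.
by rewrite ler_wpM2l ?is_norm_ge0// cvnorm_ge.
Qed.

Lemma is_norm_continuous : continuous N.
Proof.
have [C C0 NC] := is_norm_le; move=> x; have FF := nbhs_filter x.
apply/cvgrPdist_lt => e e0; near=> y.
have h a b : N a - N b <= N (a - b).
  by case: hN => ND _ _; have := ND (a - b) b; rewrite subrK lerBlDr.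
apply: (@le_lt_trans _ _ (N (x - y))).
  by rewrite ler_norml h andbT lerNl opprB (le_trans (h _ _))// -opprB is_norm_opp.
apply: (le_lt_trans (NC _)); rewrite mulrC -ltr_pdivlMr//.
by near: y; apply: (@near_dist_lt _ 'cV[R]_n); exact: divr_gt0.
Unshelve. all: by end_near. Qed.

Lemma is_norm_ge : exists2 c, 0 < c & forall x, `|x| <= c * N x.
Proof.
pose S := [set x : 'cV[R]_n | `|x| = 1].
have [S0|S0] := eqVneq S set0.
  exists 1 => // x; have [->|x0] := eqVneq x 0.
    by rewrite normr0 is_norm_0 mulr0.
  have : S (`|x|^-1 *: x).
    by rewrite /S /= normrZ normfV normr_id mulVf ?normr_eq0.
  by rewrite S0.
have cS : compact S.
  apply: cV_compact.
    by exists 1; split => // y y1 x /= ->; exact: ltW.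
  have -> : S = (@Num.norm R _) @^-1` [set 1] by [].
  by apply: closed_comp; [move=> ? _; exact: norm_continuous|exact: closed_eq].
have S0' : S !=set0 by apply/set0P.
have [x] := compact_EVT_min S0' cS (continuous_subspaceT is_norm_continuous).
rewrite inE => Sx xmin.
have x0 : 0 < N x.
  rewrite lt_neqAle is_norm_ge0 andbT eq_sym; apply/eqP.
  by case: hN => _ _ N0 /N0 xE; move: Sx; rewrite /S /= xE normr0; lra.
exists (N x)^-1 => [|y]; first by rewrite invr_gt0.
have [->|y0] := eqVneq y 0; first by rewrite normr0 is_norm_0 mulr0.
have Sy : S (`|y|^-1 *: y).
  by rewrite /S /= normrZ normfV normr_id mulVf ?normr_eq0.
have := xmin _ (mem_set Sy); case: hN => _ -> _.
rewrite normfV normr_id mulrC ler_pdivlMr ?normr_gt0// => h.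
by rewrite mulrC ler_pdivlMr// mulrC.
Qed.
End norm_equivalence.

Lemma cvnorm_chain (R : realType) n (u1 u2 u3 u4 : 'cV[R]_n) (c1 c2 c3 c : R) :
  `|u1 - u2| <= c1 -> `|u2 - u3| <= c2 -> `|u3 - u4| <= c3 ->
  c1 + c2 + c3 <= c -> `|u1 - u4| <= c.
Proof.
move=> h1 h2 h3; apply: le_trans.
rewrite (le_trans (ler_distD u3 _ _))// lerD//.
by rewrite (le_trans (ler_distD u2 _ _))// lerD.
Qed.

Lemma closed_ball_compact (R : realType) n (x0 : 'cV[R]_n) (r : R) :
  compact [set y : 'cV[R]_n | `|y - x0| <= r].
Proof.
apply: cV_compact.
  exists (r + `|x0|); split; first exact: num_real.
  move=> M rM y /= yr; rewrite -[y](subrK x0) (le_trans (ler_normD _ _))//.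
  by rewrite (le_trans _ (ltW rM))// lerD2r.
have -> : [set y : 'cV[R]_n | `|y - x0| <= r] =
   (fun y : 'cV[R]_n => `|y - x0|) @^-1` [set t | t <= r] by [].
apply: closed_comp; last exact: closed_le.
move=> y _; apply: (@continuous_comp _ _ _ (fun y : 'cV[R]_n => y - x0)
  (@Num.norm R 'cV[R]_n)); last exact: norm_continuous.
apply: (@continuousB _ 'cV[R]_n 'cV[R]_n id (cst x0)).
  by move=> z; exact: cvg_id.
exact: cst_continuous.
Qed.

(** * The tangent cone and nearest points *)

Lemma itv_at_right (R : realType) (a b : R) :
  a < b -> \forall t \near a^'+, `]a, b[%classic t.
Proof.
move=> ab; near=> t; rewrite /= in_itv/=; apply/andP; split.
  by near: t; exact: nbhs_right_gt.
by near: t; exact: nbhs_right_lt.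
Unshelve. all: by end_near. Qed.

Lemma inf_norm_ge0 (R : realType) n (N : 'cV[R]_n -> R) (hN : is_norm N)
    (A : set 'cV[R]_n) (x : 'cV[R]_n) : 0 <= inf [set N (x - y) | y in A].
Proof.
have [->|/set0P A0] := eqVneq A set0; first by rewrite image_set0 inf0.
apply: lb_le_inf; first by case: A0 => y Ay; exists (N (x - y)); exists y.
by move=> _ [y _ <-]; exact: is_norm_ge0.
Qed.

(** This is how tangency is used: the lower limit and the infimum are replaced
    by one short step h and one point y of the set. *)
Lemma tangent_cone_step (R : realType) n (N : 'cV[R]_n -> R) (hN : is_norm N)
    (A : set 'cV[R]_n) (x z : 'cV[R]_n) (e delta : R) :
  A x -> tangent_cone N A x z -> 0 < e -> 0 < delta ->
  exists h y, [/\ 0 < h, h < delta, A y & N (x + h *: z - y) < e * h].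
Proof.
move=> Ax; rewrite /tangent_cone /= limf_einfE => Tz e0 delta0.
pose f (h : R) := (h^-1 * inf [set N (x + h *: z - y) | y in A])%:E.
rewrite -/f in Tz.
have : (ereal_inf (f @` `]0%R, delta[) < e%:E)%E.
  apply: (@le_lt_trans _ _ 0%E); last by rewrite lte_fin.
  rewrite -Tz; apply: ereal_sup_ubound => /=; exists `]0%R, delta[%classic => //.
  exact: itv_at_right.
move=> /ereal_inf_lt[_ [h hI <-]].
move: hI; rewrite /= in_itv/= => /andP[h0 hd].
rewrite /f lte_fin mulrC ltr_pdivrMr// => /inf_lt[|_ [y Ay <-] hy].
  by exists (N (x + h *: z - x)); exists x.
by exists h, y.
Qed.

(** A lower limit is concerned, so it is enough that good steps h exist
    arbitrarily close to 0; this weak form is the one that linear maps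
    transport. *)
Lemma tangent_cone_of_steps (R : realType) n (N : 'cV[R]_n -> R)
    (hN : is_norm N) (A : set 'cV[R]_n) (x z : 'cV[R]_n) :
  (forall e delta : R, 0 < e -> 0 < delta ->
     exists h y, [/\ 0 < h, h < delta, A y & N (x + h *: z - y) <= e * h]) ->
  tangent_cone N A x z.
Proof.
move=> Az; rewrite /tangent_cone /= limf_einfE.
pose f (h : R) := (h^-1 * inf [set N (x + h *: z - y) | y in A])%:E.
rewrite -/f.
apply/le_anti/andP; split.
  apply/ereal_supP => _ [V [delta /= delta0 dV] <-]; apply/lee_addgt0Pr => e e0.
  rewrite add0e; have [h [y [h0 hd Ay hy]]] := Az e delta e0 delta0.
  have Vh : V h by apply: dV => //=; rewrite sub0r normrN gtr0_norm.
  apply: (@le_trans _ _ (f h)); first by apply: ereal_inf_lbound; exists h.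
  rewrite lee_fin mulrC ler_pdivrMr//; apply: le_trans hy.
  apply: ge_inf; last by exists y.
  by exists 0 => _ [w _ <-]; exact: is_norm_ge0.
apply: (@le_trans _ _ (ereal_inf (f @` `]0%R, 1%R[))).
  apply/ereal_infP => _ [h hI <-].
  move: hI; rewrite /= in_itv/= => /andP[h0 _].
  by rewrite lee_fin mulr_ge0 ?invr_ge0 ?(ltW h0)// inf_norm_ge0.
apply: ereal_sup_ubound => /=; exists `]0%R, 1%R[%classic => //.
exact: itv_at_right.
Qed.

Lemma tangent_cone_of_near (R : realType) n (N : 'cV[R]_n -> R) (hN : is_norm N)
    (A : set 'cV[R]_n) (x z : 'cV[R]_n) :
  (forall e, 0 < e ->
     \forall h \near (0 : R)^'+, exists2 y, A y & N (x + h *: z - y) <= e * h) ->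
  tangent_cone N A x z.
Proof.
move=> Az; apply: tangent_cone_of_steps => // e delta e0 delta0.
have [h [/=]] := filter_ex (filterI (Az e e0) (itv_at_right delta0)).
by move=> [y Ay hy]; rewrite in_itv/= => /andP[h0 hd]; exists h, y.
Qed.

Lemma tangent_cone_interior (R : realType) n (N : 'cV[R]_n -> R)
    (hN : is_norm N) (A : set 'cV[R]_n) (x z : 'cV[R]_n) :
  A° x -> tangent_cone N A x z.
Proof.
move=> Ax; apply: tangent_cone_of_near => // e e0.
have /nbhs_ballP[r /= r0 rA] : nbhs x A by [].
near=> h; have h0 : 0 < h by near: h; exact: nbhs_right_gt.
exists (x + h *: z); last by rewrite subrr is_norm_0 ?mulr_ge0 ?ltW.
apply: rA; rewrite -ball_normE /= opprD addNKr normrN normrZ (gtr0_norm h0).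
apply: (@le_lt_trans _ _ (h * (`|z| + 1))).
  by rewrite ler_wpM2l ?(ltW h0)// lerDl.
by rewrite -ltr_pdivlMr ?ltr_wpDl//; near: h; apply: nbhs_right_lt;
   rewrite divr_gt0// ltr_wpDl.
Unshelve. all: by end_near. Qed.

(** The distance is Euclidean, whichever norm defines the tangent cone: only
    a scalar product makes x - p orthogonal to the set in the sense of
    nearest_tangent_le0. *)
Definition nearest (R : realType) n (K : set 'cV[R]_n) (x p : 'cV[R]_n) :=
  K p /\ forall y, K y -> dot (x - p) (x - p) <= dot (x - y) (x - y).

Lemma coord_comp_continuous (R : realType) n (T : topologicalType)
    (u : T -> 'cV[R]_n) i :
  continuous u -> continuous (fun t => u t i 0 : R).
Proof.
move=> cu t.
apply: (@continuous_comp _ _ _ u (fun M : 'cV[R]_n => M i 0) t (cu t)).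
exact: coord_continuous.
Qed.

Lemma dot_continuous (R : realType) n (T : topologicalType)
    (u v : T -> 'cV[R]_n) :
  continuous u -> continuous v -> continuous (fun t => dot (u t) (v t)).
Proof.
move=> cu cv.
have addc : continuous (fun x : R * R => x.1 + x.2) by exact: add_continuous.
apply: (@continuous_big R 'I_n +%R 0 xpredT addc T _
  (fun i t => u t i 0 * v t i 0)) => i _ t.
by apply: cvgM; exact: coord_comp_continuous.
Qed.

Lemma ex_nearest (R : realType) n (K : set 'cV[R]_n) (x : 'cV[R]_n) :
  compact K -> K !=set0 -> exists p, nearest K x p.
Proof.
move=> cK K0.
have cd : continuous (fun y : 'cV[R]_n => dot (x - y) (x - y)).
  have cs : continuous (fun y : 'cV[R]_n => x - y).
    move=> y; apply: (@continuousB _ 'cV[R]_n 'cV[R]_n (cst x) id).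
      exact: cst_continuous.
    by move=> z; exact: cvg_id.
  exact: dot_continuous.
have [p Kp hp] := compact_EVT_min K0 cK (continuous_subspaceT cd).
exists p; split=> [|y Ky]; first by rewrite inE in Kp.
exact: hp (mem_set Ky).
Qed.

(** A proximal normal makes an obtuse angle with tangent vectors.  Let y in K be
    within o(h) of p + h z.  Since y is no closer to x than p is, expanding
    |x - y|^2 gives 2 h <x - p, z> <= o(h).  Because p is interior to the ball,
    y stays in it for small h, so that nearness inside the ball is enough. *)
Lemma nearest_tangent_le0 (R : realType) n (N : 'cV[R]_n -> R)
    (hN : is_norm N) (K : set 'cV[R]_n) (x0 x p z : 'cV[R]_n) (rho : R) :
  nearest (K `&` [set y | `|y - x0| <= rho]) x p -> `|p - x0| < rho ->
  tangent_cone N K p z -> dot (x - p) z <= 0.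
Proof.
move=> [[Kp _] np] prho Tz; rewrite leNgt; apply/negP => xz0.
have [c c0 hc] := is_norm_ge hN.
set a := dot (x - p) z in xz0.
pose b : R := n%:R * `|x - p| * c + 1.
have b0 : 0 < b.
  by apply: ltr_wpDl => //; rewrite !mulr_ge0// (ltW c0).
(* The expansion compares 2 h a with the error of the step and a quadratic
   term; e bounds the first by h a, and delta makes the second, at most h^2 k,
   smaller than h a. *)
pose e := Num.min 1 (a / b / 2).
have e0 : 0 < e by rewrite lt_min ltr01 !divr_gt0.
pose m : R := `|z| + c + 1.
have m0 : 0 < m by apply: ltr_wpDl => //; rewrite addr_ge0// (ltW c0).
pose k : R := n%:R * m * m + 1.
have k0 : 0 < k by apply: ltr_wpDl => //; rewrite !mulr_ge0// (ltW m0).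
pose delta := Num.min ((rho - `|p - x0|) / m) (a / k).
have d0 : 0 < delta by rewrite lt_min !divr_gt0// subr_gt0.
have [h [y [h0 hd Ky hy]]] := tangent_cone_step hN Kp Tz e0 d0.
pose r := y - p - h *: z.
have yE : y = p + (h *: z + r) by rewrite /r !subrKC.
have rle : `|r| <= c * e * h.
  have -> : `|r| = `|p + h *: z - y|.
    by rewrite /r -normrN !opprB addrA (addrC _ p).
  by rewrite (le_trans (hc _))// -mulrA ler_wpM2l ?ltW.
have e1 : e <= 1 by rewrite ge_min lexx.
have wle : `|h *: z + r| <= h * m.
  rewrite (le_trans (ler_normD _ _))// normrZ (gtr0_norm h0) /m.
  have : c * e * h <= c * h.
    by rewrite ler_wpM2r ?(ltW h0)// -[leRHS]mulr1 ler_wpM2l// ltW.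
  lra.
have Ky' : (K `&` [set y | `|y - x0| <= rho]) y.
  split => //=; have -> : y - x0 = (p - x0) + (h *: z + r).
    by rewrite yE -addrA [RHS]addrAC addrA.
  rewrite (le_trans (ler_normD _ _))// addrC -lerBrDr (le_trans wle)//.
  by rewrite -ler_pdivlMr// ltW// (lt_le_trans hd)// ge_min lexx.
have := np _ Ky'.
set w := h *: z + r in yE wle.
have -> : x - y = (x - p) - w by rewrite yE opprD addrA.
rewrite [leRHS]dotBB.
have -> : dot (x - p) w = h * a + dot (x - p) r by rewrite dotDr dotZr.
have := dot_norm_le w w; rewrite ler_norml => /andP[_ ww].
have := dot_norm_le (x - p) r; rewrite ler_norml => /andP[xr _].
have {}ww : dot w w <= k * h * h.
  rewrite (le_trans ww)// /k.
  have w2 : `|w| * `|w| <= (h * m) * (h * m) by rewrite ler_pM.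
  have := ler_wpM2l (ler0n R n) w2; have := mulr_gt0 h0 h0; lra.
have {}xr : - (a / 2 * h) <= dot (x - p) r.
  apply: le_trans xr; rewrite lerN2.
  have h1 : n%:R * (`|x - p| * `|r|) <= b * e * h.
    have : n%:R * (`|x - p| * `|r|) <= n%:R * (`|x - p| * (c * e * h)).
      by rewrite ler_wpM2l// ler_wpM2l.
    rewrite /b; have := mulr_gt0 e0 h0; lra.
  rewrite (le_trans h1)// ler_wpM2r ?(ltW h0)// mulrC -ler_pdivlMr//.
  by rewrite /e mulrAC ge_min lexx orbT.
have : h < a / k by rewrite (lt_le_trans hd)// ge_min lexx orbT.
rewrite ltr_pdivlMr// => hk.
have : h * (h * k) < h * a by rewrite ltr_pM2l.
lra.
Qed.

(** * Measurability, and integrals over a segment *)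

(** A function that is measurable on each of countably many measurable pieces;
    the pieces are the fibers of J. *)
Lemma measurable_select d (T : measurableType d) (R : realType) (I : countType)
    (J : T -> I) (G : I -> T -> R) :
  (forall i, measurable (J @^-1` [set i])) ->
  (forall i, measurable_fun setT (G i)) ->
  measurable_fun setT (fun t => G (J t) t).
Proof.
move=> mJ mG _ Y mY.
have -> : [set: T] `&` (fun t => G (J t) t) @^-1` Y =
    \bigcup_i (J @^-1` [set i] `&` (G i @^-1` Y)).
  by apply/seteqP; split=> [t [_ Yt]|t [i _ [/= Jt Yt]]];
    [exists (J t)|split => //=; rewrite Jt].
apply: countable_bigcupT_measurable => // i.
by apply: measurableI => //; rewrite -[X in measurable X]setTI; exact: mG.
Qed.

Lemma measurable_floor_fiber d (T : measurableType d) (R : realType)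
    (g : T -> R) (z : int) :
  measurable_fun setT g -> measurable [set t | Num.floor (g t) = z].
Proof.
move=> mg.
have -> : [set t | Num.floor (g t) = z] =
    setT `&` g @^-1` `[z%:~R, (z + 1)%:~R[%classic.
  apply/seteqP; split=> [t /= <-|t [_ /=]]; rewrite in_itv/=.
    by split => //; exact: floor_itv.
  by move=> /floor_def.
exact: mg.
Qed.

(** Rounding the coordinates of q to the grid of mesh 1/(m+1) leaves countably
    many values, so g of the rounded map is measurable; by continuity of g it
    tends to g o q. *)
Lemma measurable_continuous_comp d (T : measurableType d) (R : realType) k
    (g : 'cV[R]_k -> R) (q : T -> 'cV[R]_k) :
  continuous g -> (forall i, measurable_fun setT (fun t => q t i 0)) ->
  measurable_fun setT (g \o q).
Proof.
move=> cg mq.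
pose J m t : 'cV[int]_k := \col_i Num.floor (m.+1%:R * q t i 0).
pose G m (z : 'cV[int]_k) : 'cV[R]_k := \col_i ((z i 0)%:~R / m.+1%:R).
apply: (@measurable_fun_cvg _ _ _ _ (fun m t => g (G m (J m t)))) => [m|t _].
  apply: (@measurable_select _ _ _ _ (J m) (fun z _ => g (G m z))) => // z.
  have -> : J m @^-1` [set z] =
      \bigcap_(i in [set: 'I_k]) [set t | Num.floor (m.+1%:R * q t i 0) = z i 0].
    apply/seteqP; split=> [t /= <- i _ /=|t /= Jt]; first by rewrite mxE.
    by apply/colP => i; rewrite mxE; exact: Jt.
  apply: fin_bigcap_measurable => // i _; apply: measurable_floor_fiber.
  exact: measurable_funM.
apply: (@cvg_comp _ _ _ (fun m => G m (J m t)) g _ (nbhs (q t))); last exact: cg.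
apply/cvgrPdist_le => e e0; near=> m.
apply: cvnorm_le => [|i]; first exact: ltW.
rewrite !mxE; set a := q t i 0; set M : R := m.+1%:R.
have M0 : 0 < M by rewrite ltr0n.
have /andP[f1 f2] := floor_itv (M * a).
have Me : M^-1 <= e.
  rewrite -[e]invrK lef_pV2 ?posrE ?invr_gt0//.
  apply: (@le_trans _ _ m%:R); last by rewrite ler_nat.
  by near: m; exact: nbhs_infty_ger.
apply: le_trans Me.
have -> : a - (Num.floor (M * a))%:~R / M = (M * a - (Num.floor (M * a))%:~R) / M.
  by rewrite mulrBl mulrAC divff ?gt_eqF// mul1r.
rewrite normrM [X in _ * X]gtr0_norm ?invr_gt0// ler_piMl ?invr_ge0 ?(ltW M0)//.
rewrite ger0_norm ?subr_ge0//; move: f2; rewrite intrD; lra.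
Unshelve. all: by end_near. Qed.

Section rint.
Context (R : realType).
Implicit Types (a b c L : R) (w : R -> R).

Definition rint a b w : R := (\int[@lebesgue_measure R]_(s in `[a, b]) w s)%R.

Lemma itv_integrable a b L w : measurable_fun setT w ->
  (forall s, `|w s| <= L) ->
  (@lebesgue_measure R).-integrable `[a, b] (EFin \o w).
Proof.
move=> mw wL; apply: measurable_bounded_integrable => //.
- by rewrite /= lebesgue_measure_itv/=; case: ifPn => // _; rewrite -EFinB ltry.
- exact: measurable_funTS.
- exists L; split; first exact: num_real.
  by move=> M LM s _ /=; rewrite (le_trans (wL s))// ltW.
Qed.

Lemma rint_chasles a b c L w : measurable_fun setT w ->
  (forall s, `|w s| <= L) -> a <= b -> b <= c ->
  rint a c w = rint a b w + rint b c w.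
Proof.
move=> mw wL ab bc.
have := @Rintegral_itvB R w (BLeft a) (BRight c) b (itv_integrable a c mw wL).
rewrite !bnd_simp => /(_ ab bc).
rewrite Rintegral_itv_obnd_cbnd; last first.
  by apply: integrableS (itv_integrable b c mw wL) => //; apply: subset_itvr;
    rewrite bnd_simp.
by rewrite /rint => <-; rewrite subrKC.
Qed.

Lemma rint_bound a b L (e : R) w : measurable_fun setT w ->
  (forall s, `|w s| <= L) -> a <= b -> (forall s, a <= s <= b -> `|w s| <= e) ->
  `|rint a b w| <= e * (b - a).
Proof.
move=> mw wL ab we.
have iw := itv_integrable a b mw wL.
have ie : (@lebesgue_measure R).-integrable `[a, b] (EFin \o cst e).
  exact: (@itv_integrable _ _ `|e|).
apply: (le_trans (le_normr_Rintegral _ iw)) => //.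
apply: (le_trans (le_Rintegral _ (integrable_norm iw) ie _)) => //.
rewrite [leLHS](@Rintegral_cst _ _ _ (@lebesgue_measure R))//=.
rewrite lebesgue_measure_itv/= lte_fin.
case: ifPn => /= [_|]; first by [].
rewrite -leNgt => ba; have -> : b = a by apply/le_anti/andP.
by rewrite subrr.
Qed.

Lemma rint_point a w : rint a a w = 0.
Proof. by rewrite /rint set_itv1 Rintegral_set1. Qed.

(** The right endpoint is excluded because the Euler field already takes its
    next value there. *)
Lemma eq_rint a b L w1 w2 :
  measurable_fun setT w1 -> measurable_fun setT w2 ->
  (forall s, `|w1 s| <= L) -> (forall s, `|w2 s| <= L) ->
  (forall s, a <= s < b -> w1 s = w2 s) -> rint a b w1 = rint a b w2.
Proof.
move=> mw1 mw2 w1L w2L w12.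
have sub : `[a, b[ `<=` `[a, b]%classic by apply: subset_itvl; rewrite bnd_simp.
rewrite /rint -!Rintegral_itv_bndo_bndc; last 2 first.
- by apply: integrableS (itv_integrable a b mw2 w2L).
- by apply: integrableS (itv_integrable a b mw1 w1L).
by apply: eq_Rintegral => s; rewrite inE/= in_itv/=; exact: w12.
Qed.

Lemma rintZ a b L w k : measurable_fun setT w ->
  (forall s, `|w s| <= L) -> rint a b (fun s => k * w s) = k * rint a b w.
Proof. by move=> mw wL; rewrite /rint RintegralZl//; exact: itv_integrable wL. Qed.

Lemma rintB_cst a b L w (c : R) : measurable_fun setT w ->
  (forall s, `|w s| <= L) -> a <= b ->
  rint a b (fun s => w s - c) = rint a b w - (b - a) * c.
Proof.
move=> mw wL ab; rewrite /rint RintegralB//.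
- congr (_ - _); rewrite [LHS](@Rintegral_cst _ _ _ (@lebesgue_measure R))//=.
  rewrite lebesgue_measure_itv/= lte_fin mulrC.
  case: ifPn => /= [_|]; first by [].
  rewrite -leNgt => ba; have -> : b = a by apply/le_anti/andP.
  by rewrite subrr.
- exact: itv_integrable wL.
- exact: (@itv_integrable _ _ `|c| (cst c)).
Qed.

Lemma rint_sum (I : Type) (r : seq I) a b L (w : I -> R -> R) :
  (forall i, measurable_fun setT (w i)) -> (forall i s, `|w i s| <= L) ->
  rint a b (fun s => \sum_(i <- r) w i s) = \sum_(i <- r) rint a b (w i).
Proof.
move=> mw wL; elim: r => [|i r IH].
  rewrite big_nil; under [in LHS]eq_fun do rewrite big_nil.
  by rewrite /rint Rintegral_cst// mul0r.
rewrite big_cons -IH; under [in LHS]eq_fun do rewrite big_cons.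
rewrite /rint RintegralD//; first exact: itv_integrable (wL i).
apply: (@itv_integrable _ _ (\sum_(i <- r) L)).
  exact: measurable_sum.
by move=> s; rewrite (le_trans (ler_norm_sum _ _ _))// ler_sum.
Qed.

Lemma rint_le0 a b L w : measurable_fun setT w -> (forall s, `|w s| <= L) ->
  (forall s, w s <= 0) -> rint a b w <= 0.
Proof.
move=> mw wL w0; rewrite -oppr_ge0 -mulN1r -(rintZ a b _ mw wL).
by apply: Rintegral_ge0 => s _; rewrite mulN1r oppr_ge0.
Qed.

Lemma rint_dominated a b L (w_ : nat -> R -> R) w :
  (forall m, measurable_fun setT (w_ m)) -> (forall m s, `|w_ m s| <= L) ->
  (forall s, a <= s <= b -> w_ ^~ s @ \oo --> w s) ->
  (fun m => rint a b (w_ m)) @ \oo --> rint a b w.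
Proof.
move=> mw wL ww.
have iL : (@lebesgue_measure R).-integrable `[a, b] (EFin \o cst L).
  exact: (@itv_integrable _ _ `|L|).
have wwD s : `[a, b]%classic s -> w_ ^~ s @ \oo --> w s.
  by rewrite /= in_itv/=; exact: ww.
have [] := @dominated_convergence _ _ _ (@lebesgue_measure R) `[a, b]%classic _
  (fun m => EFin \o w_ m) (EFin \o w) (EFin \o cst L) _ _ _ iL _ => //.
- by move=> m; apply/measurable_EFinP; apply: measurable_funTS; exact: mw.
- apply/measurable_EFinP; apply: (@measurable_fun_cvg _ _ _ _ w_) => // m.
  by apply: measurable_funTS; exact: mw.
- by apply: aeW => s Ds; apply/cvg_EFin; [exact: nearW|exact: wwD].
- by apply: aeW => s m _ /=; rewrite lee_fin.
move=> iw _ cw; rewrite /rint /Rintegral; apply: fine_cvg.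
by rewrite fineK//; exact: integrable_fin_num.
Qed.

(** Lebesgue differentiation theorem. *)
Lemma rint_derivable a L w : measurable_fun setT w -> (forall s, `|w s| <= L) ->
  {ae @lebesgue_measure R, forall t, a < t -> is_derive t (1 : R) (rint a ^~ w) (w t)}.
Proof.
move=> mw wL.
have lw : locally_integrable [set: R] w.
  split => //; first exact: openT.
  move=> K _ cK.
  have /integrableP[_] : (@lebesgue_measure R).-integrable K (EFin \o w).
    apply: measurable_bounded_integrable => //.
    - exact: compact_measurable.
    - exact: compact_finite_measure.
    - exact: measurable_funTS.
    - exists L; split; first exact: num_real.
      by move=> M LM s _ /=; rewrite (le_trans (wL s))// ltW.
  by [].
have := @FTC1 R w (BLeft a) (fun y => itv_integrable a y mw wL) lw.
apply: filterS; first exact: (ae_filter_ringOfSetsType (@lebesgue_measure R)).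
move=> t /= h ta; have [|dF F'] := h; first by rewrite lte_fin.
by split; [exact: dF|rewrite -derive1E; exact: F'].
Qed.
End rint.

(** * Integrals of vector-valued functions *)

(** This is Borel measurability of w, expressed without a sigma-algebra on
    vectors. *)
Definition coord_measurable (R : realType) n (w : R -> 'cV[R]_n) :=
  forall i, measurable_fun setT (fun s => w s i 0).

Lemma is_derive_cV (R : realType) n (x : R -> 'cV[R]_n) (t : R) (v : 'cV[R]_n) :
  (forall i, is_derive t (1 : R) (fun s => x s i 0) (v i 0)) ->
  is_derive t (1 : R) x v.
Proof.
move=> dx; have dv : derivable x t 1.
  by apply/derivable_mxP => i j; rewrite ord1; have [] := dx i.
split => //; rewrite derive_mx//; apply/colP => i; rewrite mxE.
by have [_ ->] := dx i.
Qed.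

Section vint.
Context (R : realType) (n : nat).
Implicit Types (a b c L : R) (w : R -> 'cV[R]_n).

Definition vint a b w : 'cV[R]_n := \col_i rint a b (fun s => w s i 0).

Lemma coord_bound L w : (forall s, `|w s| <= L) -> forall i s, `|w s i 0| <= L.
Proof. by move=> wL i s; rewrite (le_trans (cvnorm_ge _ _)). Qed.

Lemma vint_chasles a b c L w : coord_measurable w -> (forall s, `|w s| <= L) ->
  a <= b -> b <= c -> vint a c w = vint a b w + vint b c w.
Proof.
move=> mw wL ab bc; apply/colP => i; rewrite !mxE.
exact: (rint_chasles (mw i) (coord_bound wL i)).
Qed.

Lemma vint_bound a b L w : coord_measurable w -> (forall s, `|w s| <= L) -> a <= b ->
  `|vint a b w| <= L * (b - a).
Proof.
move=> mw wL ab; apply: cvnorm_le => [|i].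
  by rewrite mulr_ge0 ?subr_ge0// (le_trans _ (wL a)).
rewrite mxE; apply: (rint_bound (mw i) (coord_bound wL i) ab) => s _.
exact: coord_bound.
Qed.

Lemma vint_dist_cst a b L (e : R) w (c : 'cV[R]_n) :
  coord_measurable w -> (forall s, `|w s| <= L) -> a <= b ->
  0 <= e -> (forall s, a <= s <= b -> `|w s - c| <= e) ->
  `|vint a b w - (b - a) *: c| <= e * (b - a).
Proof.
move=> mw wL ab e0 we; apply: cvnorm_le => [|i].
  by rewrite mulr_ge0 ?subr_ge0.
rewrite !mxE -(rintB_cst (c i 0) (mw i) (coord_bound wL i) ab).
apply: (@rint_bound _ _ _ (L + `|c|)) => //.
- exact: measurable_funB.
- move=> s; rewrite (le_trans (ler_normB _ _))// lerD ?cvnorm_ge//.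
  exact: coord_bound.
- move=> s sab; have := cvnorm_ge (w s - c) i; rewrite !mxE => /le_trans; apply.
  exact: we.
Qed.

Lemma vint_point a w : vint a a w = 0.
Proof. by apply/colP => i; rewrite !mxE rint_point. Qed.

Lemma eq_vint a b L w1 w2 : coord_measurable w1 -> coord_measurable w2 ->
  (forall s, `|w1 s| <= L) -> (forall s, `|w2 s| <= L) ->
  (forall s, a <= s < b -> w1 s = w2 s) -> vint a b w1 = vint a b w2.
Proof.
move=> mw1 mw2 w1L w2L w12; apply/colP => i; rewrite !mxE.
apply: (eq_rint (mw1 i) (mw2 i) (coord_bound w1L i) (coord_bound w2L i)) => s ab.
by rewrite w12.
Qed.

(** Integration commutes with the linear form dot u; this carries the sign of
    the proximal inequality from the field to its integral. *)
Lemma dot_vint u a b L w : coord_measurable w -> (forall s, `|w s| <= L) ->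
  dot u (vint a b w) = rint a b (fun s => dot u (w s)).
Proof.
move=> mw wL; rewrite /dot.
rewrite (@rint_sum _ _ _ _ _ (`|u| * L) (fun i s => u i 0 * w s i 0)).
- apply: eq_bigr => i _; rewrite mxE.
  by rewrite (rintZ _ _ _ (mw i) (coord_bound wL i)).
- by move=> i; apply: measurable_funM => //; exact: mw.
- by move=> i s; rewrite normrM ler_pM ?cvnorm_ge ?coord_bound.
Qed.

Lemma dot_vint_le0 u a b L w : coord_measurable w -> (forall s, `|w s| <= L) ->
  (forall s, dot u (w s) <= 0) -> dot u (vint a b w) <= 0.
Proof.
move=> mw wL uw; rewrite (dot_vint _ _ _ mw wL).
apply: (@rint_le0 _ _ _ (n%:R * (`|u| * L))) => // [|s].
  by apply: measurable_sum => i; apply: measurable_funM => //; exact: mw.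
by rewrite (le_trans (dot_norm_le _ _))// ler_wpM2l// ler_wpM2l.
Qed.

Lemma vint_derivable a L w (x0 : 'cV[R]_n) : coord_measurable w ->
  (forall s, `|w s| <= L) ->
  {ae @lebesgue_measure R, forall t, a < t ->
     is_derive t (1 : R) (fun s => x0 + vint a s w) (w t)}.
Proof.
move=> mw wL.
have AF := ae_filter_ringOfSetsType (@lebesgue_measure R).
have : {ae @lebesgue_measure R, forall t, forall i, a < t ->
     is_derive t (1 : R) (rint a ^~ (fun s => w s i 0)) (w t i 0)}.
  by apply: filter_forall => i; exact: rint_derivable (mw i) (coord_bound wL i).
apply: filterS => t /= ht at_; apply: is_derive_cV => i.
have -> : (fun s => (x0 + vint a s w) i 0) =
    (fun s => cst (x0 i 0) s + rint a s (fun r => w r i 0)).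
  by apply/funext => s; rewrite !mxE.
rewrite -[w t i 0]add0r; apply: is_deriveD; exact: ht.
Qed.
End vint.

(** * Euler schemes driven by a measurable field *)

Section euler.
Context (R : realType) (n : nat) (G : 'cV[R]_n -> R -> 'cV[R]_n).
Context (t0 h L : R) (x0 : 'cV[R]_n).
Hypotheses (mG : forall X, coord_measurable (G X)) (GL : forall X s, `|G X s| <= L).
Hypothesis h0 : 0 < h.

Definition euler_time j : R := t0 + j%:R * h.

Fixpoint euler_node j : 'cV[R]_n :=
  if j is i.+1 then
    euler_node i + vint (euler_time i) (euler_time i.+1) (G (euler_node i))
  else x0.

Definition euler_index s : nat := Num.truncn ((s - t0) / h).

(** The field along the scheme depends on s twice: through the node frozen
    since the last grid time and through s itself, so that a measurable input is
    not sampled. *)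
Definition euler_field s : 'cV[R]_n := G (euler_node (euler_index s)) s.

Definition euler_path t : 'cV[R]_n := x0 + vint t0 t euler_field.

Lemma euler_timeS j : euler_time j.+1 - euler_time j = h.
Proof. by rewrite /euler_time -natr1; ring. Qed.

Lemma euler_time_le i j : (i <= j)%N -> euler_time i <= euler_time j.
Proof. by move=> ij; rewrite lerD2l ler_wpM2r ?(ltW h0)// ler_nat. Qed.

Lemma euler_index_itv s : t0 <= s ->
  euler_time (euler_index s) <= s < euler_time (euler_index s).+1.
Proof.
move=> ts; have : 0 <= (s - t0) / h by rewrite divr_ge0 ?subr_ge0// ltW.
move=> /truncn_itv /andP[h1 h2]; apply/andP; split.
  by rewrite /euler_time -lerBrDl -ler_pdivlMr.
by rewrite /euler_time -ltrBlDl -ltr_pdivrMr.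
Qed.

Lemma euler_index_eq j s : euler_time j <= s < euler_time j.+1 ->
  euler_index s = j.
Proof.
move=> /andP[h1 h2]; apply: truncn_def.
by rewrite ler_pdivlMr// ltr_pdivrMr// lerBrDl ltrBlDl h1.
Qed.

(** The node is a function of the integer part of (s - t0) / h; negative integer
    parts give index 0. *)
Lemma euler_field_measurable : coord_measurable euler_field.
Proof.
move=> i.
pose J s := Num.floor ((s - t0) / h).
pose N (z : int) := if z is Posz j then j else 0%N.
have -> : (fun s => euler_field s i 0) =
    (fun s => G (euler_node (N (J s))) s i 0).
  by apply/funext => s; rewrite /euler_field /euler_index truncEfloor.
apply: (@measurable_select _ _ _ _ J (fun z s => G (euler_node (N z)) s i 0)).
  move=> z; apply: measurable_floor_fiber; apply: measurable_funM => //.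
  exact: measurable_funB.
by move=> z; exact: mG.
Qed.

Lemma euler_field_bound s : `|euler_field s| <= L.
Proof. exact: GL. Qed.

Lemma euler_path_node j : euler_path (euler_time j) = euler_node j.
Proof.
have mF := euler_field_measurable; have FL := euler_field_bound.
elim: j => [|j IH]; first by rewrite /euler_path /euler_time mul0r addr0 vint_point addr0.
rewrite /euler_path (@vint_chasles _ _ t0 (euler_time j) _ L)//.
- rewrite addrA -/(euler_path _) IH /=; congr (_ + _).
  apply: (@eq_vint _ _ _ _ L) => // s /euler_index_eq js.
  by rewrite /euler_field js.
- by rewrite lerDl mulr_ge0// ltW.
- exact: euler_time_le.
Qed.

Lemma euler_path_lipschitz s t : t0 <= s -> s <= t ->
  `|euler_path t - euler_path s| <= L * (t - s).
Proof.
move=> ts st; have mF := euler_field_measurable; have FL := euler_field_bound.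
rewrite /euler_path (vint_chasles mF FL ts st).
have -> : x0 + (vint t0 s euler_field + vint s t euler_field) -
    (x0 + vint t0 s euler_field) = vint s t euler_field.
  by rewrite addrA [LHS]addrC addKr.
exact: vint_bound.
Qed.

End euler.

(** * Projecting each Euler step onto the constraint *)

(** The Euclidean distance exceeds the entrywise maximum by a factor of at most
    the square root of n; n + 1 is a convenient bound for it. *)
Lemma nearest_dist (R : realType) n (K : set 'cV[R]_n) (x p y : 'cV[R]_n) :
  nearest K x p -> K y -> `|p - y| <= (n%:R + 2) * `|x - y|.
Proof.
move=> [_ np] Ky.
have h1 : `|x - p| <= (n%:R + 1) * `|x - y|.
  rewrite -ler_sqr ?nnegrE ?mulr_ge0// ?addr_ge0//.
  apply: (le_trans (dot_ge_norm _)); apply: (le_trans (np _ Ky)).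
  apply: (le_trans (ler_norm _)); apply: (le_trans (dot_norm_le _ _)).
  rewrite -expr2 exprMn ler_wpM2r ?sqr_ge0//.
  have := ler0n R n; nra.
have -> : p - y = (x - y) - (x - p) by rewrite opprB [RHS]addrC addrA subrK.
apply: (le_trans (ler_normB _ _)); lra.
Qed.

Section projected_euler.
Context (R : realType) (n : nat) (K : set 'cV[R]_n) (x0 : 'cV[R]_n) (rho : R).
Let K' := K `&` [set y | `|y - x0| <= rho].
Context (pr : 'cV[R]_n -> 'cV[R]_n) (g : 'cV[R]_n -> R -> 'cV[R]_n).
Context (t0 L T : R).
Hypotheses (K'x0 : K' x0) (prP : forall X, nearest K' X (pr X)).
Hypotheses (mg : forall p, coord_measurable (g p)).
Hypotheses (gL : forall p s, K' p -> `|g p s| <= L).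
Hypothesis (g_inward : forall X p s, nearest K' X p -> `|p - x0| < rho ->
  dot (X - p) (g p s) <= 0).
Hypotheses (T0 : 0 < T) (TL : (n%:R + 2) * (L * T) < rho).

Let G X s := g (pr X) s.
Let mG X : coord_measurable (G X). Proof. exact: mg. Qed.
Let GL X s : `|G X s| <= L. Proof. by apply: gL; case: (prP X). Qed.
Let L0 : 0 <= L. Proof. exact: le_trans (GL 0 0). Qed.

Section fixed_step.
Context (h : R).
Hypothesis h0 : 0 < h.
Let X j := euler_node G t0 h x0 j.
Let D j := dot (X j - pr (X j)) (X j - pr (X j)).

Let node_near j : j%:R * h <= T -> `|X j - x0| <= L * T.
Proof.
move=> jT; have tj : t0 <= euler_time t0 h j by rewrite lerDl mulr_ge0// ltW.
have := euler_path_lipschitz h x0 mG GL (lexx t0) tj.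
rewrite (euler_path_node _ _ mG GL h0) {1}/euler_path vint_point addr0.
by move/le_trans; apply; rewrite ler_wpM2l// /euler_time addrC addKr.
Qed.

Let node_proj_near j : j%:R * h <= T -> `|pr (X j) - x0| < rho.
Proof.
move=> jT; apply: le_lt_trans TL; apply: (le_trans (nearest_dist (prP _) K'x0)).
by rewrite ler_wpM2l ?addr_ge0// node_near.
Qed.

(** The point pr X_j competes for the distance of X_(j+1) to the set.  In the
    expansion of |X_j - pr X_j + I|^2, where I is the increment, the cross term
    is nonpositive by g_inward and only |I|^2 = O(h^2) is added. *)
Lemma node_dist j : j%:R * h <= T -> D j <= j%:R * (n%:R * (L * h) ^+ 2).
Proof.
elim: j => [_|j IH jT].
  rewrite mul0r; have [_ /(_ _ K'x0)] := prP (X 0).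
  rewrite /D {3 4}/X /= subrr; move/le_trans; apply.
  by rewrite /dot big1// => i _; rewrite mxE mul0r.
have jT' : j%:R * h <= T.
  by apply: le_trans jT; rewrite ler_wpM2r ?(ltW h0)// ler_nat.
have {}IH := IH jT'.
have [Kp _] := prP (X j); have [_ /(_ _ Kp)] := prP (X j.+1).
rewrite -/(D _) => /le_trans; apply.
set a := X j - pr (X j).
set I := vint (euler_time t0 h j) (euler_time t0 h j.+1) (G (X j)).
have -> : X j.+1 - pr (X j) = a + I by rewrite /X /= addrAC.
have aI : dot a I <= 0.
  apply: dot_vint_le0 (mG _) (GL _) _ => s; apply: g_inward => //.
  exact: node_proj_near.
have II : dot I I <= n%:R * (L * h) ^+ 2.
  apply: (le_trans (ler_norm _)); apply: (le_trans (dot_norm_le _ _)).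
  have IL : `|I| <= L * h.
    rewrite -[h in leRHS](euler_timeS t0 h j).
    by apply: vint_bound => //; apply: euler_time_le.
  by rewrite ler_wpM2l// expr2 ler_pM.
rewrite dotDD.
rewrite -natr1 mulrDl mul1r; move: IH; rewrite /D -/a; lra.
Qed.

(** On [t0, t0 + T] there are at most T / h steps, so the squared distance to
    the set is at most T n L^2 h. *)
Lemma euler_proj_close e s : 0 < e -> T * (n%:R * L ^+ 2 * h) <= (e / 2) ^+ 2 ->
  L * h <= e / 2 -> t0 <= s -> s <= t0 + T ->
  `|pr (X (euler_index t0 h s)) - euler_path G t0 h x0 s| <= e.
Proof.
move=> e0 h1 h2 ts sT.
have /andP[] := euler_index_itv h0 ts; set j := euler_index t0 h s => js sj.
have jT : j%:R * h <= T by have := le_trans js sT; rewrite lerD2l.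
have -> : pr (X j) - euler_path G t0 h x0 s =
  (X j - euler_path G t0 h x0 s) - (X j - pr (X j)).
  by rewrite opprB [RHS]addrC addrA subrK.
rewrite (le_trans (ler_normB _ _))// [e]splitr lerD//.
  rewrite distrC /X -(euler_path_node _ _ mG GL h0).
  apply: (le_trans (euler_path_lipschitz _ _ mG GL _ js)).
    by rewrite lerDl mulr_ge0// ltW.
  apply: le_trans h2; rewrite ler_wpM2l//.
  by have := euler_timeS t0 h j; lra.
rewrite -ler_sqr ?nnegrE ?divr_ge0 ?(ltW e0)//.
apply: (le_trans (dot_ge_norm _)); apply: (le_trans (node_dist jT)).
apply: le_trans h1.
have := ler_wpM2r (_ : 0 <= n%:R * L ^+ 2 * h) jT.
rewrite !mulr_ge0 ?(ltW h0)// => /(_ isT); rewrite exprMn; lra.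
Qed.
End fixed_step.

End projected_euler.

(** * Extraction of a uniform limit *)

Section ascoli.
Context (R : realType) (n : nat) (y_ : nat -> R -> 'cV[R]_n).
Context (a b L : R) (x0 : 'cV[R]_n).
Hypotheses (ab : a <= b) (L0 : 0 <= L) (ya : forall m, y_ m a = x0).
Hypothesis yL : forall m (s t : R), a <= s -> s <= t -> t <= b ->
  `|y_ m t - y_ m s| <= L * (t - s).

Let clamp t := Num.max a (Num.min t b).
Let clamp_itv t : a <= clamp t <= b.
Proof. by rewrite /clamp le_max lexx ge_max ge_min lexx orbT ab. Qed.
Let clampE (t : R) : a <= t <= b -> clamp t = t.
Proof. by move=> /andP[at_ tb]; rewrite /clamp min_l// max_r. Qed.

(** By Tychonoff's theorem the sequence clusters in the product topology, which
    controls finitely many times at once. *)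
Lemma pointwise_cluster : exists y : R -> 'cV[R]_n,
  forall k (g : 'I_k -> R) (e : R) N, (forall i, a <= g i <= b) -> 0 < e ->
  exists2 m, (N <= m)%N & forall i, `|y (g i) - y_ m (g i)| < e.
Proof.
(* Times are clamped to [a, b], because the product is taken over all reals. *)
pose z m : prod_topology (fun _ : R => 'cV[R]_n) := fun t => y_ m (clamp t).
pose P := [set f : prod_topology (fun _ : R => 'cV[R]_n) |
  forall t, [set y : 'cV[R]_n | `|y - x0| <= L * (b - a)] (f t)].
have cP : compact P.
  apply: (@tychonoff R (fun _ => 'cV[R]_n)
    (fun _ => [set y : 'cV[R]_n | `|y - x0| <= L * (b - a)])) => _.
  exact: closed_ball_compact.
have zP : (z @ \oo) P.
  exists 0%N => // m _ t; rewrite /z /= -(ya m).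
  have /andP[at_ tb] := clamp_itv t.
  by rewrite (le_trans (yL _ _ _ _))// ler_wpM2l// lerB.
have [y [_ cly]] := cP _ _ zP.
exists y => k g e N gab e0.
have zN : (z @ \oo) [set f | exists2 m, (N <= m)%N & f = z m].
  by exists N => // m /= Nm; exists m.
have FF : Filter (nbhs y) := nbhs_filter y.
have yB : nbhs y [set f | forall i : 'I_k, `|y (g i) - f (g i)| < e].
  apply: (@filter_forall _ _ (fun i f => `|y (g i) - f (g i)| < e) (nbhs y) FF) => i.
  have /= := @proj_continuous R (fun _ => 'cV[R]_n) (g i) y
    [set v | `|y (g i) - v| < e].
  apply; exact: (@near_dist_lt _ 'cV[R]_n).
have [_ [[m Nm ->] zB]] := cly _ _ zN yB.
by exists m => // i; have := zB i; rewrite /z clampE.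
Qed.

(** Equi-Lipschitz functions that are close on a fine enough finite grid are
    uniformly close. *)
Lemma uniform_cluster : exists y : R -> 'cV[R]_n,
  forall (e : R) N, 0 < e -> exists2 m, (N <= m)%N &
    forall t : R, a <= t <= b -> `|y_ m t - y t| <= e.
Proof.
have [y hy] := pointwise_cluster; exists y => e N e0.
have yLip (s t : R) : a <= s -> s <= t -> t <= b -> `|y t - y s| <= L * (t - s).
  move=> as_ st tb; suff key (d : R) : 0 < d -> `|y t - y s| <= L * (t - s) + d.
    exact/ler_addgt0Pr.
  move=> d0; pose g (i : 'I_2) := if i == 0 then s else t.
  have gab i : a <= g i <= b.
    by rewrite /g; case: ifP => _; apply/andP; split=> //;
      [exact: le_trans tb|exact: le_trans st].
  have d20 : 0 < d / 2 by exact: divr_gt0.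
  have [m _ hm] := hy _ g (d / 2) 0%N gab d20.
  have := hm ord0; have := hm ord_max; rewrite /g /= => /ltW h1 /ltW h2.
  rewrite distrC in h2.
  by apply: cvnorm_chain h1 (yL m as_ st tb) h2 _; lra.
pose dl := e / 3 / (L + 1).
have L1 : 0 < L + 1 by rewrite ltr_wpDl.
have dl0 : 0 < dl by rewrite !divr_gt0.
have Ldl : L * dl <= e / 3.
  rewrite /dl mulrCA ler_piMr ?divr_ge0 ?(ltW e0)//.
  by rewrite ler_pdivrMr// mul1r lerDl.
pose idx (t : R) := Num.truncn ((t - a) / dl).
have idxP (t : R) : a <= t -> (idx t)%:R * dl <= t - a < (idx t).+1%:R * dl.
  move=> at_; have : 0 <= (t - a) / dl by rewrite divr_ge0 ?subr_ge0// ltW.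
  by move=> /truncn_itv; rewrite ler_pdivlMr// ltr_pdivrMr.
pose g (i : 'I_(idx b).+1) := Num.min (a + i%:R * dl) b.
have gab i : a <= g i <= b.
  by rewrite /g le_min ge_min lexx orbT ab lerDl mulr_ge0// ltW.
have e30 : 0 < e / 3 by rewrite divr_gt0.
have [m Nm hm] := hy _ g _ N gab e30.
exists m => // t /andP[at_ tb].
have /andP[i1 i2] := idxP t at_.
have ik : (idx t < (idx b).+1)%N.
  rewrite -(ltr_nat R) -(ltr_pM2r dl0) (le_lt_trans i1)//.
  have /andP[_] := idxP b ab; apply: le_lt_trans; lra.
have gE : g (Ordinal ik) = a + (idx t)%:R * dl by rewrite /g /= min_l//; lra.
have /= := hm (Ordinal ik); rewrite gE; set s := a + _ => ys.
have as_ : a <= s by rewrite lerDl mulr_ge0// ltW.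
have st : s <= t by rewrite /s; lra.
have Lts : L * (t - s) <= e / 3.
  apply: le_trans Ldl; rewrite ler_wpM2l//.
  by move: i2; rewrite -natr1 /s; lra.
move/ltW : ys; rewrite distrC => ys.
have := yLip _ _ as_ st tb; rewrite distrC => yst.
by apply: cvnorm_chain (yL m as_ st tb) ys yst _; lra.
Qed.
End ascoli.

(** * Viable solutions for measurable inputs *)

Lemma cvg_comp_pair (R : realType) n k (f : 'cV[R]_n * 'cV[R]_k -> 'cV[R]_n)
    (T : Type) (F : set_system T) (u : T -> 'cV[R]_n) (v : T -> 'cV[R]_k) a b :
  Filter F -> continuous f -> u @ F --> a -> v @ F --> b ->
  (fun t => f (u t, v t)) @ F --> f (a, b).
Proof.
move=> FF cf ua vb.
apply: (@cvg_comp _ _ _ (fun t => (u t, v t)) f F (nbhs (a, b))); last exact: cf.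
exact: (@cvg_pair _ _ _ F (nbhs a) (nbhs b) _ _ _ u v).
Qed.

Lemma continuous_bounded_on (R : realType) n k
    (f : 'cV[R]_n * 'cV[R]_k -> 'cV[R]_n) (K : set 'cV[R]_n) (M : R) :
  continuous f -> compact K ->
  exists2 L, 0 < L & forall p v, K p -> `|v| <= M -> `|f (p, v)| <= L.
Proof.
move=> cf cK; have cB := @closed_ball_compact R k 0 M.
have cKB := compact_setX cK cB.
have /compact_bounded/ex_strict_bound_gt0[L L0 fL] :=
  continuous_compact (continuous_subspaceT cf) cKB.
exists L => // p v Kp vM; apply/ltW/fL; exists (p, v) => //; split => //=.
by rewrite subr0.
Qed.

Lemma coord_measurable_continuous_comp (R : realType) n k
    (f : 'cV[R]_n * 'cV[R]_k -> 'cV[R]_n) (q : R -> 'cV[R]_k) (p : 'cV[R]_n) :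
  continuous f -> coord_measurable q -> coord_measurable (fun s => f (p, q s)).
Proof.
move=> cf mq i.
apply: (@measurable_continuous_comp _ _ _ _ (fun v => f (p, v) i 0) q) => //.
apply: (@coord_comp_continuous _ _ _ (fun v => f (p, v))) => v.
have FF : Filter (nbhs (v : 'cV[R]_k)) := nbhs_filter (v : 'cV[R]_k).
exact: (@cvg_comp_pair _ _ _ f _ (nbhs (v : 'cV[R]_k)) (fun _ => p) id p v FF cf
  (@cvg_cst 'cV[R]_n p _ _ FF) cvg_id).
Qed.

Lemma coord_measurable_cvg (R : realType) n (w_ : nat -> R -> 'cV[R]_n)
    (w : R -> 'cV[R]_n) :
  (forall m, coord_measurable (w_ m)) ->
  (forall i s, (fun m => w_ m s i 0) @ \oo --> w s i 0) -> coord_measurable w.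
Proof.
move=> mw cw i.
by apply: (@measurable_fun_cvg _ _ _ _ (fun m s => w_ m s i 0)) => [m|s _];
  [exact: mw|exact: cw].
Qed.

(** The solution is returned as the primitive of a globally defined bounded
    field w, so that its Lipschitz continuity, its derivative almost everywhere
    and its right derivative at t0 can all be read off w. *)
Theorem viability_bounded (R : realType) n k (N : 'cV[R]_n -> R)
    (f : 'cV[R]_n * 'cV[R]_k -> 'cV[R]_n) (q : R -> 'cV[R]_k) (M : R)
    (K : set 'cV[R]_n) (x0 : 'cV[R]_n) (rho t0 : R) :
  is_norm N -> continuous f -> coord_measurable q -> (forall s, `|q s| <= M) ->
  closed K -> K x0 -> 0 < rho ->
  (forall p v, K p -> `|p - x0| < rho -> tangent_cone N K p (f (p, v))) ->
  exists T L w, [/\ 0 < T, coord_measurable w, (forall s, `|w s| <= L) &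
    forall t, t0 <= t <= t0 + T -> K (x0 + vint t0 t w) /\
       w t = f (x0 + vint t0 t w, q t)].
Proof.
move=> hN cf mq qM cK Kx0 rho0 tang.
pose K' := K `&` [set y | `|y - x0| <= rho].
have K'x0 : K' x0 by split => //=; rewrite subrr normr0 ltW.
have ccK' : compact K'.
  by rewrite /K' setIC; apply: compact_closedI => //; exact: closed_ball_compact.
have cK' : closed K' by apply: compact_closed => //; exact: norm_hausdorff.
have [L L0 fL] := continuous_bounded_on M cf ccK'.
have /boolp.choice[pr prP] : forall X, exists p, nearest K' X p.
  by move=> X; apply: ex_nearest => //; exists x0.
pose g p s := f (p, q s).
have mg p : coord_measurable (g p) by exact: coord_measurable_continuous_comp.
have gL p s : K' p -> `|g p s| <= L by move=> Kp; exact: fL.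
have g_in X p s : nearest K' X p -> `|p - x0| < rho -> dot (X - p) (g p s) <= 0.
  by move=> np pr0; apply: (nearest_tangent_le0 hN np pr0);
     apply: tang => //; case: np => -[].
pose n2 : R := n%:R + 2.
have n20 : 0 < n2 by rewrite ltr_wpDl.
(* Speed at most L keeps every node within L T of x0, and nearest_dist
   multiplies this by at most n2: the projected nodes stay in the open ball of
   radius rho. *)
pose T := rho / 2 / (n2 * L).
have T0 : 0 < T by rewrite !divr_gt0// mulr_gt0.
have TL : n2 * (L * T) < rho.
  rewrite mulrA /T mulrC divfK ?gt_eqF ?mulr_gt0//.
  by rewrite ltr_pdivrMr// ltr_pMr// ltr1n.
pose G X s := g (pr X) s.
have mG X : coord_measurable (G X) by exact: mg.
have GL X s : `|G X s| <= L by apply: gL; case: (prP X).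
pose h m : R := m.+1%:R^-1.
have h0 m : 0 < h m by rewrite invr_gt0.
pose P m s := pr (euler_node G t0 (h m) x0 (euler_index t0 (h m) s)).
pose w_ m := euler_field G t0 (h m) x0.
pose y_ m := euler_path G t0 (h m) x0.
have K'pr X : K' (pr X) by case: (prP X).
have K'P m s : K' (P m s) by exact: K'pr.
have hcvg : h @ \oo --> 0 by exact: cvg_harmonic.
have hsmall (c d : R) : 0 <= c -> 0 < d -> \forall m \near \oo, c * h m <= d.
  move=> c0 d0; have c1 : 0 < c + 1 by rewrite ltr_wpDl.
  have dc : 0 < d / (c + 1) by exact: divr_gt0.
  near=> m.
  have hm : h m <= d / (c + 1) by near: m; exact: (cvgr_le _ hcvg).
  apply: (@le_trans _ _ ((c + 1) * h m)); last by rewrite mulrC -ler_pdivlMr.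
  by rewrite ler_wpM2r ?(ltW (h0 m))// lerDl.
have close (e : R) : 0 < e -> \forall m \near \oo, forall s : R, t0 <= s -> s <= t0 + T ->
    `|P m s - y_ m s| <= e.
  move=> e0; near=> m => s ts sT.
  apply: (euler_proj_close K'x0 prP mg gL g_in TL (h0 m)) => //.
    rewrite mulrA; near: m; apply: hsmall; last by rewrite exprn_gt0// divr_gt0.
    by rewrite mulr_ge0 ?(ltW T0)// mulr_ge0 ?sqr_ge0.
  by near: m; apply: hsmall; [exact: ltW|exact: divr_gt0].
have ab : t0 <= t0 + T by rewrite lerDl ltW.
have [y hy] : exists y : R -> 'cV[R]_n,
  forall (e : R) m0, 0 < e -> exists2 m, (m0 <= m)%N &
    forall t : R, t0 <= t <= t0 + T -> `|y_ m t - y t| <= e.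
  apply: (@uniform_cluster _ _ y_ _ _ L x0) => //; first exact: ltW.
    by move=> m; rewrite /y_ /euler_path vint_point addr0.
  by move=> m s t ts st _; exact: euler_path_lipschitz.
have /boolp.choice[sg hsg] : forall j, exists m, forall t, t0 <= t <= t0 + T ->
    `|y_ m t - y t| <= h j /\ `|P m t - y t| <= h j + h j.
  move=> j; have [m0 _ hm0] := close _ (h0 j).
  have [m m0m hm] := hy _ m0 (h0 j); exists m => t tT; split; first exact: hm.
  have /andP[t1 t2] := tT.
  rewrite (le_trans (ler_distD (y_ m t) _ _))// lerD ?hm//.
  exact: hm0.
have Pcvg t : t0 <= t <= t0 + T -> (fun j => P (sg j) t) @ \oo --> y t.
  move=> tT; apply/cvgrPdist_le => e e0; near=> j; rewrite distrC.
  apply: (le_trans (hsg j t tT).2); rewrite -mulr2n -mulr_natl.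
  by near: j; exact: hsmall.
have ycvg t : t0 <= t <= t0 + T -> (fun j => y_ (sg j) t) @ \oo --> y t.
  move=> tT; apply/cvgrPdist_le => e e0; near=> j; rewrite distrC.
  apply: (le_trans (hsg j t tT).1); rewrite -[h j]mul1r.
  by near: j; exact: hsmall.
have K'y t : t0 <= t <= t0 + T -> K' (y t).
  move=> tT; apply: (closed_cvg _ cK' _ _ (Pcvg t tT)).
  by apply: nearW => j; exact: K'P.
(* The limit y is controlled on [t0, t0 + T] only; w vanishes elsewhere. *)
pose I s : R := \1_`[t0, t0 + T]%classic s.
pose w s : 'cV[R]_n := I s *: f (y s, q s).
have I1 s : t0 <= s <= t0 + T -> I s = 1.
  by move=> sT; rewrite /I indicE mem_set//= in_itv.
have I0 s : ~~ (t0 <= s <= t0 + T) -> I s = 0.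
  by move=> sT; rewrite /I indicE memNset//= in_itv/=; apply/negP.
have fcvg i s : t0 <= s <= t0 + T ->
    (fun j => w_ (sg j) s i 0) @ \oo --> f (y s, q s) i 0.
  move=> sT; apply: (@cvg_comp _ _ _ (fun j => w_ (sg j) s)
    (fun v : 'cV[R]_n => v i 0) _ (nbhs (f (y s, q s)))).
    apply: (@cvg_comp_pair _ _ _ f nat \oo (fun j => P (sg j) s) (fun _ => q s)).
    - exact: cf.
    - exact: Pcvg.
    - exact: cvg_cst.
  exact: coord_continuous.
have wcvg i s : (fun j => (I s *: w_ (sg j) s) i 0) @ \oo --> w s i 0.
  have [sT|sT] := boolP (t0 <= s <= t0 + T).
    rewrite /w (I1 _ sT) scale1r; under eq_fun do rewrite scale1r.
    exact: fcvg.
  rewrite /w (I0 _ sT) scale0r; under eq_fun do rewrite scale0r.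
  exact: cvg_cst.
have mw_ m : coord_measurable (w_ m) by exact: (euler_field_measurable _ _ _ mG).
have mIw m : coord_measurable (fun s => I s *: w_ m s).
  move=> i; under eq_fun do rewrite mxE.
  by apply: measurable_funM; [exact: measurable_indic|exact: mw_].
have mw : coord_measurable w by apply: (coord_measurable_cvg (fun m => mIw (sg m)) wcvg).
have wL s : `|w s| <= L.
  have [sT|sT] := boolP (t0 <= s <= t0 + T).
    by rewrite /w (I1 _ sT) scale1r fL//; exact: K'y.
  by rewrite /w (I0 _ sT) scale0r normr0 ltW.
have yE t : t0 <= t <= t0 + T -> y t = x0 + vint t0 t w.
  move=> tT; apply/colP => i.
  have c1 : (fun j => y_ (sg j) t i 0) @ \oo --> y t i 0.
    apply: (@cvg_comp _ _ _ (fun j => y_ (sg j) t)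
      (fun v : 'cV[R]_n => v i 0) _ (nbhs (y t))); first exact: ycvg.
    exact: coord_continuous.
  have c2 : (fun j => y_ (sg j) t i 0) @ \oo --> (x0 + vint t0 t w) i 0.
    have -> : (fun j => y_ (sg j) t i 0) =
        (fun j => x0 i 0 + rint t0 t (fun s => w_ (sg j) s i 0)).
      by apply/funext => j; rewrite !mxE.
    rewrite !mxE; apply: cvgD; first exact: cvg_cst.
    apply: (@rint_dominated _ _ _ L (fun j s => w_ (sg j) s i 0)).
    - by move=> m; exact: mw_.
    - move=> m; apply: coord_bound => s; exact: (euler_field_bound _ _ _ GL).
    - move=> s /andP[ts st]; have sT : t0 <= s <= t0 + T.
        by rewrite ts (le_trans st)//; case/andP: tT.
      by rewrite /w (I1 _ sT) scale1r; exact: fcvg.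
  exact: (cvg_unique (@Rhausdorff R) c1 c2).
exists T, L, w; split => // t tT; rewrite -yE//; split; first by case: (K'y t tT).
by rewrite /w (I1 _ tT) scale1r.
Unshelve. all: by end_near. Qed.

(** Lebesgue measure is not null, so the essential supremum is the genuine one
    in the definition of the norm. *)
Lemma Lfun_ooP (R : realType) (g : R -> R) :
  g \in Lfun (@lebesgue_measure R) +oo%E <->
  measurable_fun setT g /\
  exists M, {ae @lebesgue_measure R, forall t, `|g t| <= M}.
Proof.
have AF := ae_filter_ringOfSetsType (@lebesgue_measure R).
have muT : (0 < @lebesgue_measure R setT)%E.
  by rewrite -set_itvNyy lebesgue_measure_itv/= lt0y.
split=> [/andP[/set_mem mg /set_mem/=]|[mg [M gM]]].
  rewrite /finite_norm unlock /= muT => gfin; split => //.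
  have [M hM] := @ess_supr_bounded _ _ _ (@lebesgue_measure R) (fun t => `|g t|) gfin.
  by exists M.
apply/andP; split; apply/mem_set => //=.
rewrite /finite_norm unlock /= muT (@le_lt_trans _ _ M%:E) ?ltry//.
by apply/ess_supP; apply: filterS gM => t /=; rewrite lee_fin.
Qed.

(** Solutions depend on the input only up to null sets, so it can be assumed
    bounded everywhere. *)
Lemma Linfty_clamp (R : realType) k (q : R -> 'cV[R]_k) : Linfty q ->
  exists qc M, [/\ coord_measurable qc, forall s, `|qc s| <= M &
    {ae @lebesgue_measure R, forall s, qc s = q s}].
Proof.
have AF := ae_filter_ringOfSetsType (@lebesgue_measure R).
move=> qL.
have /boolp.choice[M hM] : forall i, exists M,
    {ae @lebesgue_measure R, forall t, `|q t i 0| <= M}.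
  by move=> i; have /Lfun_ooP[] := qL i.
pose S := \sum_i `|M i|.
have MS i : M i <= S.
  by rewrite (le_trans (ler_norm _))// /S (bigD1 i)//= lerDl sumr_ge0.
have S0 : 0 <= S by exact: sumr_ge0.
pose qc s : 'cV[R]_k := \col_i Num.max (- S) (Num.min (q s i 0) S).
exists qc, S; split.
- move=> i; under eq_fun do rewrite mxE.
  have /Lfun_ooP[mq _] := qL i.
  by apply: measurable_maxr => //; apply: measurable_minr.
- move=> s; apply: cvnorm_le => // i; rewrite mxE ler_norml.
  rewrite le_max lexx ge_max ge_min lexx orbT andbT /=; lra.
- have : {ae @lebesgue_measure R, forall s, forall i, `|q s i 0| <= M i}.
    by apply: filter_forall => i; exact: hM.
  apply: filterS => s qs; apply/colP => i; rewrite mxE.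
  have := le_trans (qs i) (MS i); rewrite ler_norml => /andP[h1 h2].
  by rewrite min_l// max_r.
Qed.

Lemma solution_of_integral (R : realType) n k
    (f : 'cV[R]_n * 'cV[R]_k -> 'cV[R]_n) (q : R -> 'cV[R]_k) (t0 T L : R)
    (x0 : 'cV[R]_n) (w : R -> 'cV[R]_n) :
  t0 < T -> coord_measurable w -> (forall s, `|w s| <= L) ->
  {ae @lebesgue_measure R, forall t, t0 < t -> t < T ->
    w t = f (x0 + vint t0 t w, q t)} ->
  solution f q t0 x0 T%:E (fun t => x0 + vint t0 t w).
Proof.
have AF := ae_filter_ringOfSetsType (@lebesgue_measure R).
move=> tT mw wL wf; split.
- by rewrite lte_fin.
- by rewrite vint_point addr0.
- move=> b tb _ e e0.
  have L0 : 0 <= L by exact: le_trans (wL 0).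
  have L1 : 0 < L + 1 by rewrite ltr_wpDl.
  exists (e / (L + 1)) => [|m u v huv _ hsum]; first exact: divr_gt0.
  apply: (@le_lt_trans _ _ ((L + 1) * \sum_(i < m) (v i - u i))).
    rewrite mulr_sumr; apply: ler_sum => i _.
    have [tu [uv vb]] := huv i (ltn_ord i).
    have -> : x0 + vint t0 (v i) w - (x0 + vint t0 (u i) w) = vint (u i) (v i) w.
      by rewrite (vint_chasles mw wL tu uv) addrA [LHS]addrC addKr.
    apply: (le_trans (vint_bound mw wL uv)).
    by rewrite ler_wpM2r ?subr_ge0// lerDl.
  by rewrite mulrC -ltr_pdivlMr.
- have := vint_derivable t0 x0 mw wL; move: wf.
  apply: filterS2 => t wf dx tt; rewrite lte_fin => tT'.
  by rewrite -wf//; exact: dx.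
Qed.

Theorem viability (R : realType) n k (N : 'cV[R]_n -> R)
    (f : 'cV[R]_n * 'cV[R]_k -> 'cV[R]_n) (q : R -> 'cV[R]_k)
    (K : set 'cV[R]_n) (x0 : 'cV[R]_n) (rho t0 : R) :
  is_norm N -> continuous f -> Linfty q -> closed K -> K x0 -> 0 < rho ->
  (forall p v, K p -> `|p - x0| < rho -> tangent_cone N K p (f (p, v))) ->
  exists T x, solution f q t0 x0 T%:E x /\ forall t, t0 <= t <= T -> K (x t).
Proof.
have AF := ae_filter_ringOfSetsType (@lebesgue_measure R).
move=> hN cf qL cK Kx0 rho0 tang.
have [qc [M [mq qM qq]]] := Linfty_clamp qL.
have [T [L [w [T0 mw wL hw]]]] :=
  viability_bounded t0 hN cf mq qM cK Kx0 rho0 tang.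
exists (t0 + T), (fun t => x0 + vint t0 t w); split=> [|t /hw[]//].
apply: (solution_of_integral _ mw wL); first by rewrite ltrDl.
apply: filterS qq => t <- tt tT; have [|//] := hw t.
by rewrite !ltW.
Qed.

(** * Time translation *)

(** The image of Lebesgue measure under a translation agrees with it on
    half-open intervals, hence everywhere. *)
Lemma ae_translate (R : realType) (c : R) (P : R -> Prop) :
  {ae @lebesgue_measure R, forall t, P t} ->
  {ae @lebesgue_measure R, forall t, P (t + c)}.
Proof.
move=> [B [mB B0 PB]].
pose tr (t : measurableTypeR R) : measurableTypeR R := (t + c)%R.
have mtr : measurable_fun setT tr by apply: measurable_funD.
exists (tr @^-1` B); split.
- by rewrite -[X in measurable X]setTI; exact: mtr.
- rewrite -B0; apply/esym.
  pose nu := measure_function_pushforward__canonical__measure_function_Measure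
    (@lebesgue_measure R) mtr.
  apply: (@lebesgue_measure_unique _ nu) => // _ [[a b] _ <-].
  rewrite /= /pushforward.
  have -> : tr @^-1` `]a, b]%classic = `]a - c, b - c]%classic.
    by apply/seteqP; split=> t /=; rewrite !in_itv/= /tr ltrBlDr lerBrDr.
  rewrite !lebesgue_measure_itv/= !lte_fin ltrD2r -!EFinB.
  by rewrite opprD opprK addrACA addNr addr0.
- by move=> t /= nP; apply: PB.
Qed.

Lemma Linfty_shift (R : realType) k (q : R -> 'cV[R]_k) (c : R) :
  Linfty q -> Linfty (fun t => q (t + c)).
Proof.
move=> qL i; have /Lfun_ooP[mq [M qM]] := qL i; apply/Lfun_ooP; split.
  have mtr : measurable_fun setT (fun t : R => t + c) by apply: measurable_funD.
  exact: measurableT_comp mq mtr.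
by exists M; exact: (ae_translate c qM).
Qed.

Lemma is_derive_translate (R : realType) n (x : R -> 'cV[R]_n) (t c : R) v :
  is_derive (t + c) (1 : R) x v -> is_derive t (1 : R) (fun s => x (s + c)) v.
Proof.
move=> [dx xv].
have E : (fun h : R => h^-1 *: (((fun s => x (s + c)) \o shift t) (h *: 1) - x (t + c)))
  = (fun h : R => h^-1 *: ((x \o shift (t + c)) (h *: 1) - x (t + c))).
  by apply/funext => h /=; rewrite addrA.
by split; [rewrite /derivable E|rewrite /derive E].
Qed.

(** The uniqueness and origin hypotheses only concern the initial time t0;
    since the dynamics is autonomous and every shifted input is admissible, they
    apply at any later time tau. *)
Lemma solution_shift (R : realType) n k
    (f : 'cV[R]_n * 'cV[R]_k -> 'cV[R]_n) (q : R -> 'cV[R]_k) (t0 tau : R)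
    (x0 : 'cV[R]_n) (x : R -> 'cV[R]_n) :
  t0 <= tau -> solution f q t0 x0 +oo%E x ->
  solution f (fun t => q (t + (tau - t0))) t0 (x tau) +oo%E
    (fun t => x (t + (tau - t0))).
Proof.
move=> t0tau [_ x0E xac xd]; set c := tau - t0.
have c0 : 0 <= c by rewrite subr_ge0.
split; first by rewrite ltry.
- by rewrite /c addrC subrK.
- move=> b tb _ e e0.
  have [|delta d0 hd] := xac (b + c) _ (ltry _) e e0.
    by rewrite (le_trans tb)// lerDl.
  exists delta => // m u v huv tI hs.
  have := hd m (fun i => u i + c) (fun i => v i + c); apply.
  + move=> i im; have [h1 [h2 h3]] := huv i im.
    by rewrite !lerD2r; split=> //; rewrite (le_trans h1)// lerDl.
  + apply/trivIsetP => i j /= im jm ij; have /trivIsetP/(_ i j im jm ij) := tI.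
    move=> /seteqP[h _]; apply/seteqP; split=> // r [].
    rewrite /= !in_itv/= => /andP[h1 h2] /andP[h3 h4].
    by apply: (h (r - c)); split;
      rewrite /= in_itv/=; apply/andP; rewrite ltrBrDr ltrBlDr.
  + by under eq_bigr do rewrite opprD addrACA subrr addr0.
- have AF := ae_filter_ringOfSetsType (@lebesgue_measure R).
  have := ae_translate c xd; apply: filterS => t dx tt _.
  have tc : t0 < t + c by rewrite (lt_le_trans tt)// lerDl.
  have {}dx := dx tc (ltry _).
  exact: is_derive_translate.
Qed.

(** * Maximal extension of a solution *)

Section zorn_extension.
Context (R : realType) (n k : nat) (f : 'cV[R]_n * 'cV[R]_k -> 'cV[R]_n).
Context (q : R -> 'cV[R]_k) (t0 : R) (x0 : 'cV[R]_n).

(** A preorder on pairs of an end time and a trajectory; it is not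
    antisymmetric, since values past the end time are ignored. *)
Definition extends (z1 z2 : \bar R * (R -> 'cV[R]_n)) :=
  (z1.1 <= z2.1)%E /\ forall t, t0 <= t -> (t%:E < z1.1)%E -> z2.2 t = z1.2 t.

Lemma extends_refl z : extends z z.
Proof. by split. Qed.

Lemma extends_trans z1 z2 z3 : extends z1 z2 -> extends z2 z3 -> extends z1 z3.
Proof.
move=> [T12 x12] [T23 x23]; split; first exact: le_trans T23.
by move=> t t0t tT; rewrite x23// ?x12// (lt_le_trans tT).
Qed.

Definition solves z := solution f q t0 x0 z.1 z.2.

(** The union is defined pointwise by choosing a member of the chain that is
    still alive.  Countably many members, with end times tending to the supremum,
    already cover the whole interval, so the exceptional null sets add up to a
    null set. *)
Lemma chain_union (A : set (\bar R * (R -> 'cV[R]_n))) :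
  A !=set0 -> A `<=` solves ->
  (forall z1 z2, A z1 -> A z2 -> extends z1 z2 \/ extends z2 z1) ->
  exists2 z, solves z & forall z', A z' -> extends z' z.
Proof.
have AF := ae_filter_ringOfSetsType (@lebesgue_measure R).
move=> A0 Asol Atot.
pose Ts := ereal_sup [set z.1 | z in A].
have AT z : A z -> (z.1 <= Ts)%E by move=> Az; apply: ereal_sup_ubound; exists z.
have agree z1 z2 t : A z1 -> A z2 -> t0 <= t -> (t%:E < z1.1)%E ->
    (t%:E < z2.1)%E -> z1.2 t = z2.2 t.
  by move=> A1 A2 tt t1 t2; have [[_ ->]|[_ ->]] := Atot _ _ A1 A2.
have [z0 Az0] := A0.
pose pick t : \bar R * (R -> 'cV[R]_n) :=
  xget z0 [set z | A z /\ (t%:E < z.1)%E].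
pose X t := (pick t).2 t.
have XE z t : A z -> t0 <= t -> (t%:E < z.1)%E -> X t = z.2 t.
  move=> Az tt tz; rewrite /X /pick; case: xgetP => [y _ [Ay ty]|/(_ z) []//].
  exact: agree.
exists (Ts, X); last by move=> z Az; split; [exact: AT|move=> t; exact: XE].
split => /=.
- by have [h _ _ _] := Asol _ Az0; exact: lt_le_trans h (AT _ Az0).
- by have [h h0 _ _] := Asol _ Az0; rewrite (XE z0).
- move=> b tb /ereal_sup_gt[_ [z Az <-] bz] e e0.
  have [_ _ /(_ b tb bz e e0)[d d0 hd] _] := Asol _ Az.
  exists d => // m u v huv tI hs.
  under eq_bigr => i _.
    have [h1 [h2 h3]] := huv i (ltn_ord i).
    have vz : ((v i)%:E < z.1)%E by rewrite (le_lt_trans _ bz)// lee_fin.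
    have uz : ((u i)%:E < z.1)%E by rewrite (le_lt_trans _ vz)// lee_fin.
    rewrite (XE z (v i)) ?(XE z (u i))//; last exact: le_trans h2.
    over.
  exact: hd.
- have S0 : [set z.1 | z in A] != set0 by apply/set0P; exists z0.1; exists z0.
  have [u uA uTs] := ereal_sup_seq S0.
  have /boolp.choice[zz hzz] : forall j, exists z, A z /\ z.1 = u j.
    by move=> j; have [z Az <-] := uA j; exists z.
  have : {ae @lebesgue_measure R, forall t, forall j : nat, t0 < t ->
      (t%:E < (zz j).1)%E -> is_derive t (1 : R) (zz j).2 (f ((zz j).2 t, q t))}.
    by apply: ae_foralln => j; have [_ _ _] := Asol _ (hzz j).1.
  apply: filterS => t ht tt tTs.
  have [j tj] : exists j, (t%:E < u j)%E.
    apply: contrapT => hn; suff : (Ts <= t%:E)%E by rewrite leNgt tTs.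
    rewrite /Ts -(cvg_lim _ uTs)//; apply: lime_le.
      by apply/cvg_ex; exists (ereal_sup [set z.1 | z in A]).
    by apply: nearW => j; rewrite leNgt; apply/negP => tj; apply: hn; exists j.
  have [Aj zj] := hzz j; rewrite -zj in tj.
  have dz := ht j tt tj.
  rewrite (XE (zz j))//; last exact: ltW.
  apply: near_eq_is_derive dz.
  have nt : \forall s \near t, (s%:E < (zz j).1)%E.
    move: tj; case: (zz j).1 => [r|_|//]; last first.
      by near=> s; rewrite ltry.
    by rewrite lte_fin => tr; near=> s; rewrite lte_fin; near: s; exact: lt_nbhsl.
  near=> s; have ts : t0 < s by near: s; exact: lt_nbhsr.
  have sz : (s%:E < (zz j).1)%E by near: s; exact: nt.
  by apply/esym; exact: XE (ltW ts) sz.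
Unshelve. all: by end_near. Qed.

Lemma maximal_extension (T : \bar R) x : solution f q t0 x0 T x ->
  exists T' y, [/\ (T <= T')%E, maximal_solution f q t0 x0 T' y &
    forall t, t0 <= t -> (t%:E < T)%E -> y t = x t].
Proof.
move=> sx.
pose P := {z | solves z /\ extends (T, x) z}.
pose base : P := exist _ (T, x) (conj sx (extends_refl _)).
pose ext (z1 z2 : P) := `[< extends (sval z1) (sval z2) >].
have [|||z zmax] := @ZL_preorder P base ext.
- by move=> z; apply/asboolP; exact: extends_refl.
- move=> z1 z2 z3 /asboolP h1 /asboolP h2; apply/asboolP.
  exact: extends_trans h2.
- move=> A Atot; have [->|/set0P[z1 Az1]] := eqVneq A set0; first by exists base.
  have [|||z sz Az] := @chain_union [set sval z | z in A].
  + by exists (sval z1); exists z1.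
  + by move=> _ [z Az <-]; case: (svalP z).
  + move=> _ _ [y1 Ay1 <-] [y2 Ay2 <-].
    by have [/asboolP h|/asboolP h] := Atot _ _ Ay1 Ay2; [left|right].
  have ez : extends (T, x) z.
    apply: (extends_trans (svalP z1).2); apply: Az; by exists z1.
  exists (exist _ z (conj sz ez)) => y Ay; apply/asboolP; apply: Az.
  by exists y.
have [sz [Tz xz]] := svalP z.
exists (sval z).1, (sval z).2; split => //; split => // -[T' [y [TT' sy yz]]].
have ezy : extends (sval z) (T', y) by split => //; exact: ltW.
have ey : extends (T, x) (T', y) by exact: extends_trans ezy.
have := zmax (exist _ (T', y) (conj sy ey)).
move=> /(_ (asboolT ezy)) /asboolP[/= + _].
by rewrite leNgt TT'.
Qed.
End zorn_extension.

(** * Dilations *)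

Lemma cV_continuous (R : realType) n (T : topologicalType) (u : T -> 'cV[R]_n) :
  (forall i, continuous (fun t => u t i 0)) -> continuous u.
Proof.
move=> cu t; apply/cvgrPdist_le => e e0.
have : \forall s \near t, forall i, `|u t i 0 - u s i 0| <= e.
  by apply: filter_forall => i; move: e e0; apply/cvgrPdist_le; exact: cu.
apply: filterS => s hs; apply: cvnorm_le => [|i]; first exact: ltW.
by rewrite !mxE.
Qed.

Lemma mx_cvgn (R : realType) m n (u : nat -> 'M[R]_(m, n)) (v : 'M[R]_(m, n)) :
  (forall i j, (fun l => u l i j) @ \oo --> v i j) -> u @ \oo --> v.
Proof.
move=> cu; apply/cvgrPdist_le => e e0.
have : \forall l \near \oo, forall ij : 'I_m * 'I_n,
    `|v ij.1 ij.2 - u l ij.1 ij.2| <= e.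
  by apply: filter_forall => -[i j] /=; move: e e0; apply/cvgrPdist_le; exact: cu.
apply: filterS => l hl; rewrite [leLHS]/Num.Def.normr /= mx_normrE.
by apply: bigmax_le => [|ij _]; [exact: ltW|rewrite !mxE; exact: hl].
Qed.

Section entire_series.
Context (R : realType).
Implicit Types (c : nat -> R) (C g s : R).

(** Domination by the coefficients of C e^(g s); the class is stable under
    termwise differentiation. *)
Definition exp_bounded C g c := forall k, `|c k| <= C * (g ^+ k / k`!%:R).

Lemma exp_bounded_cvg C g c s : 0 <= C -> 0 <= g -> exp_bounded C g c ->
  cvgn (pseries c s).
Proof.
move=> C0 g0 cb; apply: normed_cvg.
have := is_cvg_series_exp_coeff (g * `|s|).
move=> /(is_cvg_seriesZ (k := C)).
apply: series_le_cvg => k /=; first by [].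
  by rewrite mulr_ge0// /exp_coeff /= mulr_ge0 ?invr_ge0// exprn_ge0// mulr_ge0.
rewrite normrM normrX /exp_coeff /=.
rewrite -[leRHS]/(C * ((g * `|s|) ^+ k / k`!%:R)) exprMn.
apply: (le_trans (ler_wpM2r _ (cb k))); first exact: exprn_ge0.
by rewrite -!mulrA [_^-1 * _]mulrC !mulrA.
Qed.

Lemma exp_bounded_diffs C g c : exp_bounded C g c ->
  exp_bounded (C * g) g (pseries_diffs c).
Proof.
move=> cb k; rewrite /pseries_diffs normrM ger0_norm//.
have k0 : 0 < k.+1%:R :> R by rewrite ltr0n.
apply: (le_trans (ler_wpM2l (ltW k0) (cb k.+1))).
rewrite factS natrM exprS invfM.
suff -> : k.+1%:R * (C * (g * g ^+ k * (k.+1%:R^-1 * k`!%:R^-1))) =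
    C * g * (g ^+ k / k`!%:R) by [].
by field; rewrite !gt_eqF// ltr0n fact_gt0.
Qed.

Lemma exp_bounded_continuous C g c : 0 <= C -> 0 <= g -> exp_bounded C g c ->
  continuous (fun s => limn (pseries c s)).
Proof.
move=> C0 g0 cb s.
have cb1 := exp_bounded_diffs cb; have cb2 := exp_bounded_diffs cb1.
have C1 : 0 <= C * g by exact: mulr_ge0.
pose K := `|s| + 1.
have sK : `|s| < `|K| by rewrite [ltRHS]ger0_norm ?addr_ge0// ltrDl.
have [ds _] := pseries_snd_diffs (exp_bounded_cvg (s := K) C0 g0 cb)
  (exp_bounded_cvg (s := K) C1 g0 cb1)
  (exp_bounded_cvg (s := K) (mulr_ge0 C1 g0) g0 cb2) sK.
by apply/differentiable_continuous/derivable1_diffP.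
Qed.
End entire_series.

Section mexp.
Context (R : realType) (n : nat) (G : 'M[R]_n).

Let B := n%:R * `|G| + 1.
Let B0 : 0 <= B. Proof. by rewrite addr_ge0// mulr_ge0. Qed.

Lemma mxpow_scale (s : R) k : (s *: G) ^+ k = s ^+ k *: (G ^+ k).
Proof.
elim: k => [|k IH]; first by rewrite !expr0 scale1r.
by rewrite !exprS IH -!mulmxE -scalemxAl -scalemxAr scalerA.
Qed.

Lemma mxpow_bound k i j : `|(G ^+ k) i j| <= B ^+ k.
Proof.
elim: k i j => [|k IH] i j.
  by rewrite !expr0 mxE; case: (i == j); rewrite ?normr1 ?normr0.
rewrite exprS -mulmxE mxE (le_trans (ler_norm_sum _ _ _))//.
apply: (@le_trans _ _ (\sum_(l < n) `|G| * B ^+ k)).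
  apply: ler_sum => l _; rewrite normrM ler_pM//.
  rewrite [leRHS]/Num.Def.normr /= mx_normrE.
  exact: (le_bigmax _ (fun ij : 'I_n * 'I_n => `|G ij.1 ij.2|) (i, l)).
rewrite sumr_const card_ord -mulr_natl mulrA exprS ler_wpM2r ?exprn_ge0//.
by rewrite /B lerDl.
Qed.

Let c i j k : R := (G ^+ k) i j / k`!%:R.

Let c_bounded i j : exp_bounded 1 B (c i j).
Proof.
move=> k; rewrite mul1r /c normrM normfV normr_nat.
by rewrite ler_wpM2r// mxpow_bound.
Qed.

Lemma mexpE s i j : mexp (s *: G) i j = limn (pseries (c i j) s).
Proof.
suff cv : series (fun k => (k`!%:R)^-1 *: (s *: G) ^+ k) @ \oo -->
    (\matrix_(i, j) limn (pseries (c i j) s) : 'M[R]_n).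
  by rewrite /mexp (cvg_lim _ cv) ?mxE//; exact: norm_hausdorff.
apply: mx_cvgn => i' j'; rewrite mxE.
have -> : (fun l => series (fun k => (k`!%:R)^-1 *: (s *: G) ^+ k) l i' j') =
    pseries (c i' j') s.
  apply/funext => l; rewrite /series /pseries /= summxE /series /=.
  apply: eq_bigr => k _; rewrite mxpow_scale !mxE /c; ring.
exact: (exp_bounded_cvg ler01 B0 (c_bounded i' j')).
Qed.

(** Each entry of the exponential is an everywhere convergent power series
    in s. *)
Lemma mexp_mul_continuous (x : 'cV[R]_n) :
  continuous (fun s : R => mexp (s *: G) *m x).
Proof.
apply: cV_continuous => i.
have -> : (fun s => (mexp (s *: G) *m x) i 0) =
    (fun s => dot (\col_j mexp (s *: G) i j) x).
  by apply/funext => s; rewrite mxE; apply: eq_bigr => j _; rewrite mxE.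
apply: dot_continuous; last exact: cst_continuous.
apply: cV_continuous => j.
have -> : (fun s => (\col_j mexp (s *: G) i j) j 0) =
    (fun s => limn (pseries (c i j) s)).
  by apply/funext => s; rewrite mxE mexpE.
exact: exp_bounded_continuous ler01 B0 (c_bounded i j).
Qed.
End mexp.

(** Intermediate value theorem; the limits at -oo and +oo give the values on
    both sides of 1. *)
Lemma dilation_reaches_sphere (R : realType) n (N : 'cV[R]_n -> R)
    (hN : is_norm N) (d : R -> 'M[R]_n) (x : 'cV[R]_n) :
  linear_dilation N d -> monotone_dilation N d -> x != 0 ->
  exists s, N (d s *m x) = 1.
Proof.
move=> [[G dG] dinf dsup] dmon x0.
pose g s := N (d s *m x).
have cd : continuous (fun s : R => d s *m x).
  have -> : (fun s => d s *m x) = (fun s => mexp (s *: G) *m x).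
    by apply/funext => s; rewrite dG.
  exact: mexp_mul_continuous.
have cg : continuous g.
  move=> s; apply: (@continuous_comp _ _ _ (fun s => d s *m x) N).
    exact: cd.
  exact: is_norm_continuous.
have [b gb] : exists b, 1 < g b.
  have := dinf x x0; rewrite limf_einfE => supoo.
  have : (1%:E < ereal_sup [set ereal_inf ((fun s => (g s)%:E) @` V) | V in +oo%R])%E.
    by rewrite supoo ltry.
  move=> /ereal_sup_gt[_ [V /filter_ex[b Vb] <-] hV]; exists b.
  rewrite -lte_fin; apply: (lt_le_trans hV); apply: ereal_inf_lbound.
  by exists b.
have [a ga] : exists a, g a < 1.
  have := dsup x x0; rewrite limf_esupE => inf0.
  have : (ereal_inf [set ereal_sup ((fun s => (g s)%:E) @` V) | V in -oo%R] < 1%:E)%E.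
    by rewrite inf0 lte_fin.
  move=> /ereal_inf_lt[_ [V /filter_ex[a Va] <-] hV]; exists a.
  rewrite -lte_fin; apply: le_lt_trans hV; apply: ereal_sup_ubound.
  by exists a.
have ab : a <= b.
  rewrite leNgt; apply/negP => /(dmon x x0); rewrite -/(g _) -/(g _) => h.
  by have := lt_trans gb (lt_trans h ga); rewrite ltxx.
have [|c _ gc] := IVT (v := 1) ab (continuous_subspaceT cg).
  by rewrite ge_min le_max (ltW ga) (ltW gb) orbT.
by exists c.
Qed.

(** If d(s) v = 0 with v nonzero, then N(d(s - 1) v) < 0 by monotonicity. *)
Lemma dilation_unitmx (R : realType) n (N : 'cV[R]_n -> R)
    (hN : is_norm N) (d : R -> 'M[R]_n) s :
  monotone_dilation N d -> d s \in unitmx.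
Proof.
move=> dmon; rewrite -unitmx_tr -row_free_unit -kermx_eq0.
apply/eqP/row_matrixP => i; rewrite row0.
set v := row i (kermx (d s)^T).
have v0 : d s *m v^T = 0.
  by apply: trmx_inj; rewrite trmx_mul trmxK trmx0; apply/sub_kermxP/row_sub.
apply/eqP/negPn/negP => vn0.
have vTn0 : v^T != 0 by rewrite -trmx0 (inj_eq trmx_inj).
have := dmon _ vTn0 (s - 1) s; rewrite gtrBl ltr01 => /(_ isT).
by rewrite v0 is_norm_0// ltNge is_norm_ge0.
Qed.

(** * Linear images of boundaries and tangent cones *)

Lemma mulmx_cV_bound (R : realType) n (A : 'M[R]_n) (v : 'cV[R]_n) :
  `|A *m v| <= n%:R * `|A| * `|v|.
Proof.
apply: cvnorm_le => [|i]; first by rewrite !mulr_ge0.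
rewrite mxE (le_trans (ler_norm_sum _ _ _))//.
have -> : n%:R * `|A| * `|v| = \sum_(l < n) `|A| * `|v|.
  by rewrite sumr_const card_ord -mulrA mulr_natl.
apply: ler_sum => l _; rewrite normrM ler_pM ?cvnorm_ge//.
rewrite [leRHS]/Num.Def.normr /= mx_normrE.
exact: (le_bigmax _ (fun ij : 'I_n * 'I_n => `|A ij.1 ij.2|) (i, l)).
Qed.

Lemma is_norm_mulmx (R : realType) n (N : 'cV[R]_n -> R) (A : 'M[R]_n) :
  is_norm N -> exists2 D, 0 < D & forall v, N (A *m v) <= D * N v.
Proof.
move=> hN; have [C C0 hC] := is_norm_le hN; have [c c0 hc] := is_norm_ge hN.
exists (C * (n%:R * `|A|) * c + 1) => [|v].
  by rewrite ltr_wpDl// !mulr_ge0// ltW.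
rewrite mulrDl mul1r ler_wpDr ?is_norm_ge0//.
apply: (le_trans (hC _)); rewrite -!mulrA ler_wpM2l ?(ltW C0)//.
apply: (le_trans (mulmx_cV_bound _ _)); rewrite -!mulrA !ler_wpM2l//.
Qed.

Lemma mulmx_cV_continuous (R : realType) n (A : 'M[R]_n) :
  continuous (fun v : 'cV[R]_n => A *m v).
Proof.
apply: cV_continuous => i.
have -> : (fun v : 'cV[R]_n => (A *m v) i 0) = (fun v => dot (\col_j A i j) v).
  by apply/funext => v; rewrite mxE; apply: eq_bigr => j _; rewrite mxE.
apply: dot_continuous; first exact: cst_continuous.
by move=> z; exact: cvg_id.
Qed.

(** Steps towards K at A x are pulled back by the inverse of A, which preserves
    K and distorts the norm by a bounded factor; the positive factor a only
    rescales the step. *)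
Lemma tangent_cone_image (R : realType) n (N : 'cV[R]_n -> R) (hN : is_norm N)
    (K : set 'cV[R]_n) (A : 'M[R]_n) (x z : 'cV[R]_n) (a : R) :
  A \in unitmx -> (forall y, K (A *m y) <-> K y) -> 0 < a -> K x ->
  tangent_cone N K (A *m x) (a *: (A *m z)) -> tangent_cone N K x z.
Proof.
move=> Au KA a0 Kx Tz; apply: tangent_cone_of_steps => // e delta e0 delta0.
have [D D0 hD] := is_norm_mulmx (invmx A) hN.
have KAx : K (A *m x) by apply/KA.
have [h [y [h0 hd Ky hy]]] := tangent_cone_step hN KAx Tz
  (divr_gt0 (mulr_gt0 e0 a0) D0) (divr_gt0 delta0 a0).
exists (h * a), (invmx A *m y); split.
- exact: mulr_gt0.
- by rewrite -ltr_pdivlMr.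
- by apply/KA; rewrite mulKVmx.
- have -> : x + (h * a) *: z - invmx A *m y =
      invmx A *m (A *m x + h *: (a *: (A *m z)) - y).
    by rewrite mulmxBr mulmxDr mulKmx// -!scalemxAr mulKmx// scalerA.
  apply: (le_trans (hD _)).
  have : D * N (A *m x + h *: (a *: (A *m z)) - y) <= D * (e * a / D * h).
    by rewrite ler_wpM2l ?(ltW D0)// ltW.
  move/le_trans; apply.
  have -> : D * (e * a / D * h) = e * (h * a) by field; rewrite gt_eqF.
  by [].
Qed.

Lemma closed_boundary_sub (T : topologicalType) (A : set T) x :
  closed A -> boundary A x -> A x.
Proof. by move=> cA [+ _]; rewrite -(closure_id A).1. Qed.

Lemma boundary_preimage (T U : topologicalType) (g : T -> U) (A : set U)
    (B : set T) (x : T) :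
  continuous g -> (forall y, A (g y) <-> B y) -> closed B ->
  boundary B x -> boundary A (g x).
Proof.
move=> cg AB cB bx; have Bx := closed_boundary_sub cB bx; split.
  by apply: subset_closure; apply/AB.
move=> iA; case: bx => _; apply.
have : nbhs x (g @^-1` A) by apply: cg.
by apply: filterS => y /AB.
Qed.

Lemma abs_continuous_modulus (R : realType) n (a b : R) (x : R -> 'cV[R]_n) :
  abs_continuous a b x -> forall e : R, 0 < e -> exists2 delta : R, 0 < delta &
    forall u v, a <= u -> u <= v -> v <= b -> v - u < delta -> `|x v - x u| < e.
Proof.
move=> xac e e0; have [d d0 hd] := xac e e0; exists d => // u v au uv vb uvd.
have := hd 1%N (fun _ => u) (fun _ => v); rewrite !big_ord1; apply => //.
by apply/trivIsetP => i j /=; rewrite !ltnS !leqn0 => /eqP -> /eqP ->; rewrite eqxx.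
Qed.

(** * Invariance and tangency *)

Lemma continuous_radius (R : realType) n (g : 'cV[R]_n -> 'cV[R]_n)
    (x : 'cV[R]_n) (e : R) : continuous g -> 0 < e ->
  exists2 r : R, 0 < r & forall p, `|p - x| < r -> `|g p - g x| <= e.
Proof.
move=> cg e0.
have : nbhs x (g @^-1` [set y | `|g x - y| < e]).
  by apply: cg; exact: (@near_dist_lt _ 'cV[R]_n).
move=> /nbhs_ballP[r /= r0 rg]; exists r => // p pr.
rewrite distrC; apply: ltW; apply: rg.
by rewrite -ball_normE /= distrC.
Qed.

(** The solution for the constant input v is the primitive of a field w that is
    right-continuous at t0 with w t0 = f (x0, v); its points in K at times t0 + h are
    thus within o(h) of x0 + h f(x0, v). *)
Lemma nagumo_necessity (R : realType) n k (N : 'cV[R]_n -> R)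
    (f : 'cV[R]_n * 'cV[R]_k -> 'cV[R]_n) (K : set 'cV[R]_n) (t0 : R)
    (x0 : 'cV[R]_n) (v : 'cV[R]_k) :
  is_norm N -> continuous f -> forward_complete f t0 ->
  robustly_positively_invariant f t0 K -> K x0 ->
  tangent_cone N K x0 (f (x0, v)).
Proof.
have AF := ae_filter_ringOfSetsType (@lebesgue_measure R).
move=> hN cf fc inv Kx0.
have mq : coord_measurable (fun _ : R => v) by move=> i; exact: measurable_cst.
have qL : Linfty (fun _ : R => v).
  move=> i; apply/Lfun_ooP; split; first exact: measurable_cst.
  by exists `|v i 0|; apply: aeW.
have tangT p u : setT p -> `|p - x0| < 1 ->
    tangent_cone N setT p (f (p, u)).
  by move=> _ _; apply: tangent_cone_interior => //; rewrite interiorT.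
have [T [L [w [T0 mw wL hw]]]] := viability_bounded t0 hN cf mq
  (fun _ => lexx `|v|) closedT (I : setT x0) ltr01 tangT.
have L0 : 0 <= L by exact: le_trans (wL 0).
pose x t := x0 + vint t0 t w.
have sx : solution f (fun _ => v) t0 x0 (t0 + T)%:E x.
  apply: (solution_of_integral _ mw wL); first by rewrite ltrDl.
  by apply: aeW => t tt tT; have [|] := hw t; rewrite ?(ltW tt) ?(ltW tT).
have [T' [y [TT' ymax yx]]] := maximal_extension sx.
have T'oo := fc _ _ _ _ qL ymax; rewrite {}T'oo in ymax.
have Ky t : t0 <= t -> K (y t) by exact: inv qL Kx0 ymax.1 t.
have [C C0 hC] := is_norm_le hN.
apply: tangent_cone_of_near => // e e0.
have cfv : continuous (fun p => f (p, v)).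
  move=> p; have FF : Filter (nbhs (p : 'cV[R]_n)) := nbhs_filter (p : 'cV[R]_n).
  exact: (@cvg_comp_pair _ _ _ f _ (nbhs (p : 'cV[R]_n)) id (fun _ => v) p v FF
    cf cvg_id (@cvg_cst 'cV[R]_k v _ _ FF)).
have eC : 0 < e / C by exact: divr_gt0.
have [r r0 hr] := continuous_radius x0 cfv eC.
have L1 : 0 < L + 1 by rewrite ltr_wpDl.
have rL : 0 < r / (L + 1) by exact: divr_gt0.
near=> h.
have h0 : 0 < h by near: h; exact: nbhs_right_gt.
have hT : h < T by near: h; exact: nbhs_right_lt.
have hrL : h < r / (L + 1) by near: h; exact: nbhs_right_lt.
have th : t0 <= t0 + h by rewrite lerDl ltW.
exists (y (t0 + h)); first exact: Ky.
rewrite yx//; last by rewrite lte_fin ltrD2l.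
apply: (le_trans (hC _)); rewrite mulrC -ler_pdivlMr//.
have -> : x0 + h *: f (x0, v) - x (t0 + h) =
    - (vint t0 (t0 + h) w - (t0 + h - t0) *: f (x0, v)).
  by rewrite /x opprD addrACA subrr add0r opprB [t0 + h]addrC addrK.
rewrite normrN.
have -> : e * h / C = e / C * (t0 + h - t0).
  by rewrite [t0 + h]addrC addrK mulrAC.
apply: (vint_dist_cst mw wL th (ltW eC)) => s /andP[ts sh].
have [|_ ->] := hw s; first by rewrite ts (le_trans sh)// lerD2l ltW.
apply: hr; rewrite [X in `|X|]addrC addKr.
apply: (le_lt_trans (vint_bound mw wL ts)).
apply: (@le_lt_trans _ _ ((L + 1) * h)); last by rewrite mulrC -ltr_pdivlMr.
by rewrite ler_pM// ?subr_ge0// ?lerDl// lerBlDl.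
Unshelve. all: by end_near. Qed.

(** The supremum of the times spent in K is attained because K is closed. *)
Lemma last_exit (R : realType) n (K : set 'cV[R]_n) (t0 t1 : R)
    (x : R -> 'cV[R]_n) :
  closed K -> t0 <= t1 -> K (x t0) -> ~ K (x t1) -> abs_continuous t0 t1 x ->
  exists tau, [/\ t0 <= tau, tau < t1, K (x tau) &
    forall t, tau < t -> t <= t1 -> ~ K (x t)].
Proof.
move=> cK t01 K0 nK1 xac.
pose S := [set t | t0 <= t <= t1 /\ K (x t)].
have S0 : S t0 by split=> //; rewrite lexx.
have supS : has_sup S by split; [exists t0|exists t1 => t [/andP[]]].
pose tau := sup S.
have t0tau : t0 <= tau by apply: ub_le_sup => //; case: supS.
have tau1 : tau <= t1 by apply: ge_sup => [|t [/andP[]]]; first by exists t0.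
have Ktau : K (x tau).
  rewrite ((closure_id K).1 cK) => B /nbhs_ballP[e /= e0 eB].
  have [d d0 hd] := abs_continuous_modulus xac e0.
  have [t [/andP[tt tt1] Kt] tautd] := sup_adherent d0 supS.
  exists (x t); split=> //; apply: eB; rewrite -ball_normE /=.
  have ttau : t <= tau by apply: ub_le_sup; [case: supS|split=> //; rewrite tt].
  by apply: hd => //; rewrite ltrBlDl -ltrBlDr.
exists tau; split => //.
  by rewrite lt_neqAle tau1 andbT; apply/eqP => E; apply: nK1; rewrite -E.
move=> t taut tt1 Kt; suff : t <= tau by rewrite leNgt taut.
apply: ub_le_sup; first by case: supS.
by split=> //; rewrite tt1 andbT (le_trans t0tau)// ltW.
Qed.

(** After a shift of the last exit time tau to t0, the trajectory cannot be in K
    on any right neighbourhood of t0; the origin hypothesis, openness of the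
    interior of K, or uniqueness together with a viable solution say that it
    is. *)
Lemma nagumo_sufficiency (R : realType) n k (N : 'cV[R]_n -> R)
    (f : 'cV[R]_n * 'cV[R]_k -> 'cV[R]_n) (K : set 'cV[R]_n) (t0 : R) :
  is_norm N -> continuous f -> closed K -> K 0 ->
  (forall x, boundary K x -> x != 0 -> forward_unique_at f t0 x) ->
  leaves_origin_into f t0 K ->
  (forall x, boundary K x -> x != 0 -> forall v, tangent_cone N K x (f (x, v))) ->
  robustly_positively_invariant f t0 K.
Proof.
move=> hN cf cK K0 uniq orig tang q x0 x qL Kx0 sx t1 t01.
apply: contrapT => nK1.
have [_ x0E xac _] := sx.
have xac1 := xac t1 t01 (ltry _).
have Kxt0 : K (x t0) by rewrite x0E.
have [tau [t0tau tau1 Ktau nK]] := last_exit cK t01 Kxt0 nK1 xac1.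
set c := tau - t0.
have sz := solution_shift t0tau sx; rewrite -/c in sz.
set z := (fun t => x (t + c)) in sz.
have qL' := Linfty_shift c qL.
have tauE : t0 + c = tau by rewrite /c addrC subrK.
(* Every case below contradicts this claim. *)
have leaves : ~ \forall t \near t0^'+, K (z t).
  move=> Kz; have d0 : t0 < t0 + (t1 - tau) by rewrite ltrDl subr_gt0.
  have [t [Kt]] := filter_ex (filterI Kz (itv_at_right d0)).
  rewrite /= in_itv/= => /andP[tt td]; apply: nK Kt.
    by rewrite -tauE ltrD2r.
  rewrite -lerBrDr (le_trans (ltW td))// /c.
  by rewrite opprB addrCA addrC.
have [xtau0|xtau0] := eqVneq (x tau) 0.
  apply: (leaves); rewrite xtau0 in sz.
  apply: (orig _ _ _ qL' sz t0 (lexx _) (ltry _)).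
    by move=> t tt; have <- : t0 = t by [apply/le_anti]; rewrite /z tauE.
  move=> z0; apply: (leaves); apply: filterS z0 => t ->; exact: K0.
have btau : boundary K (x tau).
  split; first exact: subset_closure.
  move=> /nbhs_ballP[r /= r0 rK]; apply: (leaves).
  have [d d0 hd] := abs_continuous_modulus xac1 r0.
  have m0 : t0 < t0 + Num.min d (t1 - tau).
    by rewrite ltrDl lt_min d0 subr_gt0.
  apply: filterS (itv_at_right m0) => t; rewrite /= in_itv/= => /andP[tt].
  rewrite -ltrBlDl lt_min => /andP[td t1d].
  apply: rK; rewrite -ball_normE /= distrC; apply: hd => //.
  - by rewrite -tauE lerD2r ltW.
  - by move: t1d; rewrite /c; lra.
  - by move: td; rewrite /c; lra.
have rho0 : 0 < `|x tau| by rewrite normr_gt0.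
have tang' p v : K p -> `|p - x tau| < `|x tau| -> tangent_cone N K p (f (p, v)).
  move=> Kp pn; have [iK|niK] := pselect (K° p).
    exact: tangent_cone_interior.
  apply: tang; first by split; [exact: subset_closure|].
  by apply/eqP => p0; move: pn; rewrite p0 sub0r normrN ltxx.
(* The radius |x tau| keeps the origin, where tangency is not assumed, out of
   the ball. *)
have [T [y [sy Ky]]] := viability t0 hN cf qL' cK Ktau rho0 tang'.
have tT : t0 < T by case: sy => /=; rewrite lte_fin.
apply: (leaves).
have zy := uniq _ btau xtau0 _ _ _ _ _ qL' sz sy.
apply: filterS (filterI zy (itv_at_right tT)) => t [/= ->].
by rewrite in_itv/= => /andP[tt tT']; apply: Ky; rewrite !ltW.
Qed.

Unset Implicit Arguments.
Theorem corollary4p8 (R : realType) (n k p : nat)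
  (Nn : 'cV[R]_n -> R) (Nk : 'cV[R]_k -> R)
  (hNn : is_norm Nn) (hNk : is_norm Nk)
  (d : R -> 'M[R]_n) (dt : R -> 'M[R]_k)
  (hd : linear_dilation Nn d) (hdmon : monotone_dilation Nn d)
  (hdt : linear_dilation Nk dt) (hdtmon : monotone_dilation Nk dt)
  (f : 'cV[R]_n * 'cV[R]_k -> 'cV[R]_n) (hf : continuous f)
  (mu : R) (hmu : -1 < mu)
  (hfhom : forall (s : R) (x : 'cV[R]_n) (q : 'cV[R]_k),
     f (d s *m x, dt s *m q) = expR (mu * s) *: (d s *m f (x, q)))
  (phi : 'I_p -> 'cV[R]_n -> R) (nu : 'I_p -> R)
  (hnu : forall i, 0 < nu i)
  (hphi : forall i, continuous (phi i))
  (hphiC1 : forall i, C1_off_origin (phi i))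
  (hphihom : forall i, homogeneous d (nu i) (phi i))
  (Omega : set 'cV[R]_n)
  (hOmega : Omega = [set x | forall i, 0 <= phi i x])
  (hint : Omega° !=set0)
  (t0 : R)
  (hcomplete : forward_complete f t0)
  (hunique : forall x0, boundary Omega x0 -> x0 != 0 ->
     forward_unique_at f t0 x0)
  (horigin : leaves_origin_into f t0 Omega) :
  robustly_positively_invariant f t0 Omega <->
  (forall x, boundary Omega x -> Nn x = 1 ->
     forall q : 'cV[R]_k, tangent_cone Nn Omega x (f (x, q))).
Proof.
have cO : closed Omega.
  have -> : Omega = \bigcap_(i in [set: 'I_p]) (phi i @^-1` [set r | 0 <= r]).
    rewrite hOmega; apply/seteqP; split=> x /= h i; first by move=> _; exact: h.
    exact: h.
  by apply: closed_bigI => i _; apply: closed_comp; [move=> x _; exact: hphi|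
    exact: closed_ge].
have phi0 i : phi i 0 = 0.
  have := hphihom i 1 0; rewrite mulmx0 mulr1 => h.
  have : (expR (nu i) - 1) * phi i 0 = 0 by rewrite mulrBl mul1r -h subrr.
  move/eqP; rewrite mulf_eq0 => /orP[|/eqP//].
  by rewrite subr_eq0 gt_eqF// expR_gt1.
have O0 : Omega 0 by rewrite hOmega /= => i; rewrite phi0.
have Od s y : Omega (d s *m y) <-> Omega y.
  rewrite hOmega /=; split=> h i; have := h i; rewrite hphihom.
    by rewrite pmulr_rge0 ?expR_gt0.
  by move=> h0; rewrite mulr_ge0 ?expR_ge0.
split=> [inv x bx _ v|tang].
  apply: (@nagumo_necessity _ _ _ _ _ _ t0) => //.
  exact: closed_boundary_sub bx.
apply: (nagumo_sufficiency hNn) => // x bx x0 v.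
have [s xs] := dilation_reaches_sphere hNn hd hdmon x0.
have bdx : boundary Omega (d s *m x).
  exact: (boundary_preimage (@mulmx_cV_continuous _ _ (d s)) (Od s) cO bx).
have := tang _ bdx xs (dt s *m v); rewrite hfhom.
apply: tangent_cone_image => //.
- exact: dilation_unitmx hNn _ _ hdmon.
- exact: expR_gt0.
- exact: closed_boundary_sub bx.
Qed.
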